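(* Let $\mathcal{X}$ be a stochastic, irreducible and aperiodic homogeneous discrete-time Markov chain on a countably infinite state space $S$, and suppose $\mathcal{X}$ is simple. Then the following are equivalent: (i) $\mathcal{X}$ is asymptotically aperiodic; (ii) $\mathcal{X}^{(m)}$ is simple for all $m>1$; (iii) $\mathcal{X}^{(m)}$ is simple for all prime numbers $m$.
   Context: $\mathcal{X}=\{X(n),\,n=0,1,\dots\}$ has an arbitrary initial distribution, and $\mathbb{P}$ is the induced probability measure on sample paths. For $m\ge 1$, $\mathcal{X}^{(m)}=\{X^{(m)}(n)=X(nm),\ n=0,1,\dots\}$ is the $m$-step chain. For a Markov chain $\mathcal{Y}=\{Y(n)\}$ on $S$ (here $\mathcal{X}$ or some $\mathcal{X}^{(m)}$) and $C\subset S$ let $U(C)=\{Y(n)\in C \text{ for infinitely many } n\}$ and $L(C)=\{Y(n)\in C\text{ for all sufficiently large }n\}$. $C$ is transient (w.r.t. $\mathcal{Y}$) if $\mathbb{P}(U(C))=0$; regular if $\mathbb{P}(U(C)\setminus L(C))=0$; almost closed if it is regular and not transient. These notions do not depend on the initial distribution. An almost closed set is atomic if it does not contain two disjoint almost closed subsets, and nonatomic otherwise. Two regular sets are equivalent if their symmetric difference is transient. A Blackwell decomposition of $S$ for $\mathcal{Y}$ is a finite or countable collection $\{C_1,C_2,\dots\}$ of disjoint almost closed sets such that (i) every $C_i$, except at most one, is atomic; (ii) the nonatomic $C_i$, if present, contains no atomic subsets and consists of transient states; (iii) $\sum_i\mathbb{P}(L(C_i))=1$. By a theorem of Blackwell such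 a decomposition exists and is unique up to equivalence; $\beta(\mathcal{Y})$ denotes the number of sets in it. $\mathcal{Y}$ is simple if $\beta(\mathcal{Y})=1$. The asymptotic period of a simple chain $\mathcal{X}$ is $d(\mathcal{X}):=\sup\{m\ge1 : \beta(\mathcal{X}^{(m)})=m\}\in\{1,2,\dots\}\cup\{\infty\}$; $\mathcal{X}$ is asymptotically aperiodic if $d(\mathcal{X})=1$. *)

(* Defs.v *)
From HB Require Import structures.
From mathcomp Require Import all_boot all_order all_algebra.
From mathcomp Require Import all_classical all_reals all_analysis.

Set Implicit Arguments.
Unset Strict Implicit.
Unset Printing Implicit Defensive.

Import Order.TTheory GRing.Theory Num.Theory.

Local Open Scope classical_set_scope.
Local Open Scope ring_scope.
Local Open Scope ereal_scope.

Section TransitionMatrix.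
Context (R : realType) (S : countType).
Implicit Types (p : S -> S -> R) (i j : S).

Definition stochastic p : Prop :=
  (forall i j, (0 <= p i j)%R) /\
  (forall i, \esum_(j in [set: S]) (p i j)%:E = 1).

Fixpoint nstep p (n : nat) i j : \bar R :=
  if n is n'.+1 then \esum_(k in [set: S]) ((p i k)%:E * nstep p n' k j)
  else (i == j)%:R%:E.

Definition irreducible p : Prop := forall i j, exists n, 0 < nstep p n i j.

Definition return_times p i : set nat :=
  [set n | (0 < n)%N /\ 0 < nstep p n i i].

(* g = gcd N, with gcd set0 = gcd [set 0] = 0 *)
Definition is_gcd_of (N : set nat) (g : nat) : Prop :=
  (forall n, N n -> (g %| n)%N) /\
  (forall e, (forall n, N n -> (e %| n)%N) -> (e %| g)%N).

Definition aperiodic p : Prop := forall i, is_gcd_of (return_times p i) 1%N.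

End TransitionMatrix.

Section Chains.
Context (R : realType) (d : measure_display) (T : measurableType d).
Context (P : probability T R) (S : countType).
Implicit Types (X Y : nat -> T -> S) (A B C : set S) (D : set (set S)).

(* X is a homogeneous Markov chain under P with transition matrix p; its
   initial distribution, the law of X 0, is unconstrained.  The Markov
   property is written without division, so that histories of probability 0
   need no separate treatment. *)
Definition markov_chain (p : S -> S -> R) X : Prop :=
  (forall n i, measurable (X n @^-1` [set i])) /\
  (forall n (s : nat -> S) j,
    P ([set w | forall k, (k <= n)%N -> X k w = s k]
         `&` X n.+1 @^-1` [set j]) =
    P [set w | forall k, (k <= n)%N -> X k w = s k] * (p (s n) j)%:E).

Definition mstep X (m : nat) : nat -> T -> S := fun n => X (n * m)%N.

Definition io_event Y C : set T :=
  [set w | forall N, exists2 n, (N <= n)%N & C (Y n w)].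

Definition ult_event Y C : set T :=
  [set w | exists N, forall n, (N <= n)%N -> C (Y n w)].

Definition transient Y C : Prop := P (io_event Y C) = 0.

Definition regular Y C : Prop := P (io_event Y C `\` ult_event Y C) = 0.

Definition almost_closed Y C : Prop := regular Y C /\ ~ transient Y C.

Definition atomic Y C : Prop :=
  almost_closed Y C /\
  ~ exists A B, [/\ A `<=` C, B `<=` C, A `&` B = set0,
                    almost_closed Y A & almost_closed Y B].

Definition nonatomic Y C : Prop := almost_closed Y C /\ ~ atomic Y C.

(* A state i is transient when it is almost surely visited only finitely
   often, i.e. when [set i] is transient. *)
Record blackwell_decomposition Y D : Prop := {
  bd_countable : countable D ;
  bd_disjoint : trivIset D id ;
  bd_almost_closed : forall C, D C -> almost_closed Y C ;
  bd_nonatomic_uniq : forall C C',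
    D C -> D C' -> nonatomic Y C -> nonatomic Y C' -> C = C' ;
  bd_nonatomic : forall C, D C -> nonatomic Y C ->
    (forall A, A `<=` C -> ~ atomic Y A) /\
    (forall i, C i -> transient Y [set i]) ;
  bd_total : \esum_(C in D) P (ult_event Y C) = 1
}.

(* The number (possibly +oo) of sets in a Blackwell decomposition for Y; xget
   selects one, the default set0 being used only if there is none. *)
Definition beta Y : \bar R := counting (xget set0 (blackwell_decomposition Y)).

Definition simple Y : Prop := beta Y = 1.

Definition asymptotic_period X : \bar R :=
  ereal_sup [set m%:R%:E | m in
    [set m : nat | (0 < m)%N /\ beta (mstep X m) = m%:R%:E]].

Definition asymptotically_aperiodic X : Prop := asymptotic_period X = 1.

End Chains.

(* Main.v *)
(* Let U(C) and L(C) denote "infinitely often in C" and "ultimately in C" for the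
   m-step chain.  By a Levy 0-1 law, C |-> L(C) matches, modulo null events, the
   regular sets with the events of the path space that are invariant under the
   m-fold shift; atomic sets correspond to atoms of this family I_m.
   If I_1 has no atom then no I_m has one (the union of the shifts of an atom of
   I_m would be an atom of I_1), and the decomposition {C} of X also decomposes
   each m-step chain.
   Otherwise I_1 is trivial.  The shift then permutes transitively the atoms of
   I_m; let k be their number, a divisor of m.  If k = 1 the m-step chain is
   simple.  If k > 1, take a prime q dividing k: grouping every q-th shift of an
   atom of I_m gives exactly q atoms of I_q, so that beta(X^(q)) = q.  Hence
   either all m-step chains are simple, or beta(X^(q)) = q for some prime q. *)
Require Import Defs.
From HB Require Import structures.
From mathcomp Require Import all_boot all_order all_algebra.
From mathcomp Require Import all_classical all_reals all_analysis.
From mathcomp Require Import lra.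
Set Implicit Arguments.
Unset Strict Implicit.
Unset Printing Implicit Defensive.
Import Order.TTheory GRing.Theory Num.Theory.
Local Open Scope classical_set_scope.
Local Open Scope ring_scope.

(** The sample space that carries the chain has no shift, so the argument is run on the path space
    under the law of the chain; [beta] is unchanged because it depends only on probabilities of
    events that pull back to the sample space. There the obstacle is the arbitrary initial law: the
    law of the path is not shift invariant, and a shift could turn a null event into a non-null one.
    Irreducibility and aperiodicity remove it: every state is occupied with positive probability at
    some time divisible by m, so a null m-invariant event has conditional probability 0 from every
    state, and shifts preserve nullity among m-invariant events. A second obstacle is that a
    decomposition asks for sets that are disjoint, not merely disjoint up to transient sets. An
    invariant event is therefore represented by the states from which its conditional probability
    exceeds 1/2: two almost disjoint events cannot both do so from the same state. *)

Lemma periodic_submonoidP (H : set nat) (m : nat) : (0 < m)%N ->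
    H 0%N -> (forall x y, H x -> H y -> H (x + y)%N) ->
    (forall x y, x = y %[mod m] -> H x -> H y) ->
  exists2 k, (0 < k)%N && (k %| m)%N & forall x, H x <-> (k %| x)%N.
Proof.
move=> m_gt0 H0 HD Hm.
have Hmul x n : H x -> H (n * x)%N.
  by move=> Hx; elim: n => [//|n IHn]; rewrite mulSn; exact: HD.
have Hmm : H m by apply: Hm H0; rewrite modnn mod0n.
have exk : exists k, `[< (0 < k)%N /\ H k >] by exists m; apply/asboolP.
case: (ex_minnP exk) => k /asboolP[k_gt0 Hk] kmin.
have Hdvd x : H x -> (k %| x)%N.
  move=> Hx; rewrite /dvdn -leqn0 leqNgt; apply/negP => r_gt0.
  suff Hr : H (x %% k)%N.
    suff : (k <= x %% k)%N by rewrite leqNgt ltn_mod k_gt0.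
    by apply: kmin; apply/asboolP.
  (* Subtracting [x %/ k] copies of [k] is not possible in [H]; adding [m.-1] times as many copies
     has the same effect modulo [m]. *)
  apply: Hm (HD _ _ Hx (Hmul _ (m.-1 * (x %/ k))%N Hk)).
  rewrite {1}(divn_eq x k) addnAC -mulnDl -mulSn prednK//.
  by rewrite -mulnA mulnC modnMDl.
exists k; first by rewrite k_gt0 Hdvd.
by move=> x; split=> [/Hdvd//|/dvdnP[n ->]]; exact: Hmul.
Qed.

(** * Measures and countable unions *)

Section countable_families.
Local Open Scope ereal_scope.
Context d (T : measurableType d) (R : realType) (I : countType).
Variable V : I -> set T.
Hypothesis mV : forall i, measurable (V i).

Let F n := if pickle_inv n is Some i then V i else set0.

Let mF n : measurable (F n).
Proof. by rewrite /F; case: pickle_inv. Qed.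

Let FE : \bigcup_i V i = \bigcup_n F n.
Proof.
apply/seteqP; split=> [x [i _ Vi]|x [n _]].
  by exists (pickle i) => //; rewrite /F pickleK_inv.
by rewrite /F; case: (pickle_inv n) => // i Vi; exists i.
Qed.

Lemma countType_bigcup_measurable : measurable (\bigcup_i V i).
Proof. by rewrite FE; exact: bigcupT_measurable. Qed.

Lemma le_measure_countable_partition (mu nu : {measure set T -> \bar R}) :
    trivIset setT V -> (forall i, mu (V i) <= nu (V i)) ->
  mu (\bigcup_i V i) <= nu (\bigcup_i V i).
Proof.
move=> tV mu_nu; rewrite FE.
have tF : trivIset setT F.
  apply/trivIsetP => /= a b _ _; rewrite /F.
  have := @pickle_invK I a; have := @pickle_invK I b.
  case: (pickle_inv a) => [i|]; case: (pickle_inv b) => [j|] /=;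
    rewrite ?set0I ?setI0// => <- <- ij.
  by move/trivIsetP : tV; apply=> //; apply: contraNneq ij => ->.
rewrite !measure_bigcup//; apply: lee_nneseries => n _ //.
by rewrite /F; case: pickle_inv => [i|]; rewrite ?measure0.
Qed.

Lemma negligible_countType_bigcup (mu : {measure set T -> \bar R}) :
  (forall i, mu.-negligible (V i)) -> mu.-negligible (\bigcup_i V i).
Proof.
move=> V0; rewrite FE; apply: negligible_bigcup => n.
by rewrite /F; case: pickle_inv => [i|]; [exact: V0|exact: negligible_set0].
Qed.

End countable_families.

Section probability_facts.
Local Open Scope ereal_scope.
Context d (T : measurableType d) (R : realType) (Q : probability T R).

Lemma fine_probability E : measurable E -> (fine (Q E))%:E = Q E.
Proof. by move=> mE; rewrite fineK// fin_num_measure. Qed.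

Lemma setT_not_negligible : ~ Q.-negligible setT.
Proof.
move=> /(measure_negligible measurableT)/(etrans (esym (probability_setT Q))).
by move=> /eqP; rewrite onee_eq0.
Qed.

Lemma probability_conegligible E :
  measurable E -> Q.-negligible (~` E) -> Q E = 1.
Proof.
move=> mE nE; rewrite -(setCK E) probability_setC; last exact: measurableC.
by rewrite (measure_negligible _ nE) ?sube0//; exact: measurableC.
Qed.

End probability_facts.

(** * The path space, its cylinders and the shift *)

Section cylinders.
Context (S : countType) (s0 : S).

(* [s0] only serves to make the path space a pointed type. *)
Definition paths : Type := let _ := s0 in nat -> S.

Definition cylinder (t : seq S) : set paths :=
  [set w | mkseq w (size t) = t].

HB.instance Definition _ := gen_eqMixin paths.
HB.instance Definition _ := gen_choiceMixin paths.
HB.instance Definition _ := isPointed.Build paths (fun=> s0).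

Let cylC (A : set paths) :
  <<s range cylinder >> A -> <<s range cylinder >> (~` A).
Proof. by move=> sA; rewrite -setTD; exact: sigma_algebraCD. Qed.

HB.instance Definition _ := @isMeasurable.Build
  (sigma_display (range cylinder)) paths <<s range cylinder >>
  (@sigma_algebra0 _ setT (range cylinder)) cylC
  (@sigma_algebra_bigcup _ setT (range cylinder)).

Definition shift (r : nat) (w : paths) : paths := fun n => w (n + r)%N.

Lemma measurable_cylinder t : measurable (cylinder t).
Proof. by apply: sub_sigma_algebra; exists t. Qed.

Lemma cylinder0 : cylinder [::] = setT.
Proof. by apply/seteqP; split. Qed.

Lemma cylinder_mkseq w n : cylinder (mkseq w n) w.
Proof. by rewrite /cylinder/= size_map size_iota. Qed.

Lemma shift_shift a b w : shift a (shift b w) = shift (a + b) w.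
Proof. by apply/funext => n; rewrite /shift addnA. Qed.

Lemma shift0 w : shift 0 w = w.
Proof. by apply/funext => n; rewrite /shift addn0. Qed.

Lemma preimage_shiftD a b E :
  shift (a + b) @^-1` E = shift b @^-1` (shift a @^-1` E).
Proof. by apply/seteqP; split=> w; rewrite /preimage/= shift_shift. Qed.

Lemma preimage_shift0 E : shift 0 @^-1` E = E.
Proof. by apply/seteqP; split=> w; rewrite /preimage/= shift0. Qed.

Lemma mkseqD (w : paths) a b : mkseq w (a + b) = mkseq w a ++ mkseq (shift a w) b.
Proof.
rewrite /mkseq iotaD map_cat; congr cat.
rewrite add0n -[in LHS](addn0 a) iotaDl -map_comp.
by apply: eq_map => k; rewrite /= /shift addnC.
Qed.

Lemma cylinder_cat t u :
  cylinder (t ++ u) = cylinder t `&` shift (size t) @^-1` cylinder u.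
Proof.
apply/seteqP; split=> w; rewrite /cylinder/= size_cat mkseqD.
  by move/eqP; rewrite eqseq_cat ?size_mkseq// => /andP[/eqP ? /eqP].
by case=> -> ->.
Qed.

Lemma last_cylinder x s w : cylinder (x :: s) w -> w (size s) = last x s.
Proof.
rewrite /cylinder /= => ws; rewrite -[RHS](last_cons x x s) -ws.
by rewrite -(@nth_last _ x) size_mkseq nth_mkseq.
Qed.

(** The shift is by [size s], one less than the length of [x :: s]: the two words overlap in the
    letter at time [size s], the present state, which belongs to both past and future. *)
Lemma cylinder_shift x s y v :
  cylinder (x :: s) `&` shift (size s) @^-1` cylinder (y :: v) =
  if y == last x s then cylinder (x :: s ++ v) else set0.
Proof.
have E w : (shift (size s) @^-1` cylinder (y :: v)) w <->
    (w (size s) = y /\ (shift (size s).+1 @^-1` cylinder v) w).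
  rewrite /preimage/= /cylinder /= -[(size v).+1]add1n mkseqD /= shift_shift add1n.
  rewrite /mkseq/= {1}/shift add0n; split=> [[-> ->]//|[-> ->]//].
case: eqP => [yE|ny]; last first.
  apply/seteqP; split=> // w [wx wyv]; have [wy _] := iffLR (E w) wyv.
  by case: ny; rewrite -wy (last_cylinder wx).
rewrite -cat_cons cylinder_cat; apply/seteqP; split=> w [ws].
  by move=> wv; have [] := iffLR (E w) wv.
by move=> wv; split=> //; apply: (iffRL (E _)); split=> //; rewrite yE (last_cylinder ws).
Qed.

(** Either one word is a prefix of the other and the cylinders are nested, or the words clash and
    the cylinders are disjoint; this is why the empty set is adjoined. *)
Lemma setI_closed_cylinder : setI_closed (set0 |` range cylinder).
Proof.
have pre t u : (size t <= size u)%N ->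
    (set0 |` range cylinder) (cylinder t `&` cylinder u).
  move=> tu; have [tE|ne] := eqVneq (take (size t) u) t.
    have uE : u = t ++ drop (size t) u.
      by rewrite -{1}(cat_take_drop (size t) u) tE.
    by right; exists u => //; rewrite uE cylinder_cat setIA setIid.
  left; apply/seteqP; split=> // w [wt wu]; move: ne => /eqP; apply=> /=.
  move: wu; rewrite -{1}(cat_take_drop (size t) u) cylinder_cat => -[+ _].
  by rewrite /cylinder/= size_takel// wt.
move=> A B [->|[t _ <-]]; first by rewrite set0I; left.
move=> [->|[u _ <-]]; first by rewrite setI0; left.
have [/pre//|/ltnW/pre] := leqP (size t) (size u).
by rewrite setIC.
Qed.

Lemma measurable_pathsE : @measurable _ paths = <<s set0 |` range cylinder >>.
Proof.
apply/seteqP; split; last first.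
  apply: smallest_sub; first exact: sigma_algebra_measurable.
  by move=> A [->|[t _ <-]]; [exact: measurable0|exact: measurable_cylinder].
by apply: sub_smallest2r => // A rA; right.
Qed.

Lemma measurable_coordinate n (C : set S) : measurable [set w : paths | C (w n)].
Proof.
have -> : [set w : paths | C (w n)] =
    \bigcup_(t : seq S)
      (if (size t == n.+1) && `[< C (last s0 t) >] then cylinder t else set0).
  apply/seteqP; split=> w /=.
    move=> Cw; exists (mkseq w n.+1) => //.
    rewrite size_mkseq eqxx -nth_last size_mkseq nth_mkseq// asboolT//.
    exact: cylinder_mkseq.
  move=> [t _]; case: ifP => // /andP[/eqP st /asboolP Ct].
  by case: t st Ct => // x s [<-] Cs /last_cylinder ->.
apply: countType_bigcup_measurable => t.
by case: ifP => // _; exact: measurable_cylinder.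
Qed.

Lemma measurable_paths_valued d (T : measurableType d) (f : T -> paths) :
  (forall t, measurable (f @^-1` cylinder t)) -> measurable_fun setT f.
Proof.
move=> mf; apply: (measurability (range cylinder)) => //.
by move=> _ [_ [t _ <-] <-]; rewrite setTI.
Qed.

Lemma measurable_shift r : measurable_fun setT (shift r).
Proof.
apply: measurable_paths_valued => t.
have -> : shift r @^-1` cylinder t =
    \bigcup_(u : seq S) (if size u == r then cylinder (u ++ t) else set0).
  apply/seteqP; split=> w.
    move=> wt; exists (mkseq w r) => //; rewrite size_mkseq eqxx.
    by rewrite cylinder_cat size_mkseq; split=> //; exact: cylinder_mkseq.
  move=> [u _]; case: ifP => // /eqP <-; rewrite cylinder_cat.
  by case.
by apply: countType_bigcup_measurable => u; case: ifP => // _; exact: measurable_cylinder.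
Qed.

Lemma measurable_shift_preimage r E :
  measurable E -> measurable (shift r @^-1` E).
Proof. by move=> mE; rewrite -[_ @^-1` _]setTI; exact: measurable_shift. Qed.

End cylinders.

(** * Approximation by events that depend on finitely many coordinates *)

Section prefix_events.
Local Open Scope ereal_scope.
Context (R : realType) (S : countType) (s0 : S).
Variable Q : probability (paths s0) R.
Implicit Types (E F G : set (paths s0)) (w : paths s0).

(** No measurability is asked: as [S] is countable, such an event is a countable disjoint union of
    cylinders of length [n]. *)
Definition prefix_event (n : nat) F :=
  forall w w', (forall k, (k < n)%N -> w k = w' k) -> F w -> F w'.

Definition prefix_cylinder (n : nat) F (t : seq S) : set (paths s0) :=
  if (size t == n) && `[< cylinder t `&` F !=set0 >] then cylinder t
  else set0.

Lemma cylinder_eq t w w' : cylinder t w -> cylinder t w' ->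
  forall k, (k < size t)%N -> w k = w' k.
Proof.
move=> wt w't k kt.
rewrite -(@nth_mkseq _ s0 w (size t))// -(@nth_mkseq _ s0 w' (size t))//.
by congr nth; rewrite wt w't.
Qed.

Lemma prefix_eventE n F : prefix_event n F -> F = \bigcup_t prefix_cylinder n F t.
Proof.
move=> Fn; apply/seteqP; split=> w.
  move=> Fw; exists (mkseq w n) => //; rewrite /prefix_cylinder size_mkseq eqxx.
  rewrite asboolT//; first exact: cylinder_mkseq.
  by exists w; split=> //; exact: cylinder_mkseq.
move=> [t _]; rewrite /prefix_cylinder.
case: ifP => // /andP[/eqP tn /asboolP[w' [w't Fw']]] wt.
by apply: Fn Fw' => k; rewrite -tn; exact: cylinder_eq.
Qed.

Lemma measurable_prefix_cylinder n F t : measurable (prefix_cylinder n F t).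
Proof. by rewrite /prefix_cylinder; case: ifP => // _; exact: measurable_cylinder. Qed.

Lemma trivIset_prefix_cylinder n F : trivIset setT (prefix_cylinder n F).
Proof.
move=> t u _ _ [w []]; rewrite /prefix_cylinder.
case: ifP => // /andP[/eqP tn _]; case: ifP => // /andP[/eqP un _].
by rewrite /cylinder/= tn un => -> ->.
Qed.

Lemma measurable_prefix_event n F : prefix_event n F -> measurable F.
Proof.
move=> /prefix_eventE ->; apply: countType_bigcup_measurable => t.
exact: measurable_prefix_cylinder.
Qed.

Lemma prefix_event_le m n F : (m <= n)%N -> prefix_event m F -> prefix_event n F.
Proof. by move=> mn Fm w w' ww'; apply: Fm => k km; exact/ww'/(leq_trans km). Qed.

Lemma prefix_eventI n F G :
  prefix_event n F -> prefix_event n G -> prefix_event n (F `&` G).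
Proof. by move=> Fn Gn w w' ww' [/(Fn _ _ ww') ? /(Gn _ _ ww')]. Qed.

Lemma prefix_eventD n F G :
  prefix_event n F -> prefix_event n G -> prefix_event n (F `\` G).
Proof.
move=> Fn Gn w w' ww' [/(Fn _ _ ww') ? nG]; split=> // Gw'; apply: nG.
by apply: Gn Gw' => k kn; rewrite ww'.
Qed.

Lemma prefix_event_cylinder t : prefix_event (size t) (cylinder t).
Proof.
move=> w w' ww'; rewrite /cylinder/= => {2}<-.
by apply/eq_in_map => k; rewrite mem_iota add0n => /andP[_ kt]; rewrite ww'.
Qed.

(** The approximable events form a lambda-system that contains the pi-system of cylinders. *)
Lemma prefix_approximation E (e : R) : measurable E -> (0 < e)%R ->
  exists n F, [/\ prefix_event n F, Q (E `\` F) < e%:E & Q (F `\` E) < e%:E].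
Proof.
pose H : set (set (paths s0)) := [set A | measurable A /\ forall e, (0 < e)%R ->
  exists n F, [/\ prefix_event n F, Q (A `\` F) < e%:E & Q (F `\` A) < e%:E]].
suff : @measurable _ (paths s0) `<=` H by move=> HE mE; apply: (HE _ mE).2.
have Hprefix n F : prefix_event n F -> H F.
  move=> Fn; split=> [|e' e'0]; first exact: measurable_prefix_event Fn.
  by exists n, F; rewrite setDv measure0 lte_fin.
rewrite measurable_pathsE; apply: lambda_system_subset => //.
- exact: setI_closed_cylinder.
- split=> //.
  + exact: (Hprefix 0%N).
  + move=> A B BA [mA HA] [mB HB]; split=> [|e' e'0]; first exact: measurableD.
    have e2 : (0 < e' / 2)%R by rewrite divr_gt0.
    have [n [F [Fn AF FA]]] := HA _ e2; have [k [G [Gk BG GB]]] := HB _ e2.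
    have Fm := prefix_event_le (leq_maxl n k) Fn.
    have Gm := prefix_event_le (leq_maxr n k) Gk.
    have mF := measurable_prefix_event Fn; have mG := measurable_prefix_event Gk.
    have half X Y Z : measurable X -> measurable Y -> measurable Z ->
        Z `<=` X `|` Y -> Q X < (e' / 2)%:E -> Q Y < (e' / 2)%:E -> Q Z < e'%:E.
      move=> mX mY mZ ZXY Xe Ye; rewrite (splitr e') EFinD.
      apply: le_lt_trans (lteD Xe Ye); apply: le_trans (measureU2 _ mX mY).
      by apply: le_measure => //; rewrite inE//; exact: measurableU.
    exists (maxn n k), (F `\` G); split.
    * exact: prefix_eventD.
    * apply: half AF GB; try (by repeat apply: measurableD).
      move=> w [[Aw nBw] nFG]; have [Fw|nFw] := pselect (F w); last by left.
      by right; split=> //; apply: contrapT => nGw; apply: nFG.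
    * apply: half FA BG; try (by repeat apply: measurableD).
      move=> w [[Fw nGw] nAB]; have [Aw|nAw] := pselect (A w); last by left.
      by right; split=> //; apply: contrapT => nBw; apply: nAB.
  + move=> A ndA HA; split=> [|e' e'0].
      by apply: bigcupT_measurable => n; exact: (HA n).1.
    have mA n : measurable (A n) := (HA n).1.
    have mUA : measurable (\bigcup_n A n) by exact: bigcupT_measurable.
    have e2 : (0 < e' / 2)%R by rewrite divr_gt0.
    (* By continuity from below a single [A N] misses at most half the tolerance, so an
       approximation of [A N] also serves the union. *)
    have [N AN] : exists N, Q (\bigcup_n A n `\` A N) < (e' / 2)%:E.
      have : Q (A n) @[n --> \oo] --> Q (\bigcup_n A n).
        exact: nondecreasing_cvg_mu.
      rewrite -(fineK (fin_num_measure Q _ mUA)) => /fine_cvgP[_].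
      move=> /cvgrPdist_lt/(_ _ e2)[N _ /(_ N (leqnn N))] /= HN.
      exists N; rewrite measureD//; last first.
        by rewrite -ge0_fin_numE// fin_num_measure.
      rewrite setIidr; last exact: bigcup_sup.
      rewrite -(fineK (fin_num_measure Q _ mUA)) -(fineK (fin_num_measure Q _ (mA N))).
      by rewrite -EFinB lte_fin (le_lt_trans (ler_norm _)).
    have [n [F [Fn AF FA]]] := (HA N).2 _ e2.
    have mF := measurable_prefix_event Fn.
    exists n, F; split=> //.
    * rewrite (splitr e') EFinD; apply: le_lt_trans (lteD AN AF).
      apply: le_trans (measureU2 _ _ _); [|exact: measurableD|exact: measurableD].
      apply: le_measure; rewrite ?inE.
      - exact: measurableD.
      - by apply: measurableU; exact: measurableD.
      - by move=> w [Uw nF]; have [?|?] := pselect (A N w); [right|left].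
    * apply: (@lt_le_trans _ _ (e' / 2)%:E); last first.
        by rewrite lee_fin ler_pdivrMr// mulr_natr mulr2n lerDl ltW.
      apply: le_lt_trans FA; apply: le_measure; rewrite ?inE; try exact: measurableD.
      by move=> w [Fw nUw]; split=> // ANw; apply: nUw; exists N.
- by move=> _ [->|[t _ <-]]; [exact: (Hprefix 0%N)|exact/Hprefix/prefix_event_cylinder].
Qed.

End prefix_events.

(** * The Markov property and a Levy 0-1 law *)

Section markov_property.
Local Open Scope ereal_scope.
Context (R : realType) (S : countType) (s0 : S).
Variables (Q : probability (paths s0) R) (p : S -> S -> R).
Implicit Types (E F G : set (paths s0)) (w : paths s0).

Definition markov_law := forall x s j,
  Q (cylinder (rcons (x :: s) j)) = Q (cylinder (x :: s)) * (p (last x s) j)%:E.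

Fixpoint path_weight i (v : seq S) : R :=
  if v is j :: v' then (p i j * path_weight j v')%R else 1%R.

Hypothesis Q_markov : markov_law.

Lemma cylinder_weight x s v :
  Q (cylinder (x :: s ++ v)) = Q (cylinder (x :: s)) * (path_weight (last x s) v)%:E.
Proof.
elim: v s => [|j v IHv] s; first by rewrite cats0 mule1.
by rewrite -cat_rcons IHv last_rcons -rcons_cons Q_markov -muleA -EFinM.
Qed.

(** The law of the shifted path restricted to [C], not normalised. The argument [mC] lets the
    measure structure declared below be inferred. *)
Definition branch (C : set (paths s0)) (mC : measurable C) (r : nat) E :=
  Q (C `&` shift r @^-1` E).

Section branch_measure.
Variables (C : set (paths s0)) (mC : measurable C) (r : nat).

Let branch0 : branch mC r set0 = 0.
Proof. by rewrite /branch preimage_set0 setI0 measure0. Qed.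

Let branch_ge0 E : 0 <= branch mC r E.
Proof. exact: measure_ge0. Qed.

Let branch_sigma_additive : semi_sigma_additive (branch mC r).
Proof.
move=> F mF tF mUF; rewrite /branch preimage_bigcup setI_bigcupr.
apply: measure_semi_sigma_additive.
- by move=> n; apply: measurableI => //; exact: measurable_shift_preimage.
- apply/trivIsetP => i j _ _ ij; rewrite setIACA setIid -[X in C `&` X]preimage_setI.
  by move/trivIsetP : tF => /(_ _ _ _ _ ij) ->//; rewrite preimage_set0 setI0.
- rewrite -setI_bigcupr -preimage_bigcup.
  by apply: measurableI => //; exact: measurable_shift_preimage.
Qed.

HB.instance Definition _ := isMeasure.Build _ _ _
  (branch mC r) branch0 branch_ge0 branch_sigma_additive.

End branch_measure.

(** Equality of the conditional laws of the future given two pasts with the same present,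
    cross-multiplied so that null cylinders need no exception. Both sides are finite measures in [E]
    that agree on cylinders. *)
Lemma markov_property x s y u E : measurable E -> last x s = last y u ->
  Q (cylinder (x :: s) `&` shift (size s) @^-1` E) * Q (cylinder (y :: u)) =
  Q (cylinder (y :: u) `&` shift (size u) @^-1` E) * Q (cylinder (x :: s)).
Proof.
move=> mE xsyu.
have mC t : measurable (@cylinder S s0 t) by exact: measurable_cylinder.
pose c t : {nonneg R} := NngNum (fine_ge0 (measure_ge0 Q (cylinder t))).
pose mu1 : {measure set _ -> \bar R} :=
  mscale (c (y :: u)) (branch (mC (x :: s)) (size s)).
pose mu2 : {measure set _ -> \bar R} :=
  mscale (c (x :: s)) (branch (mC (y :: u)) (size u)).
suff : mu1 E = mu2 E.
  by rewrite /mu1 /mu2 /= /mscale /= /branch !fine_probability// ![_ * Q (cylinder _)]muleC.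
apply: (measure_unique (set0 |` range (@cylinder S s0)) (fun=> setT)) => //.
- exact: measurable_pathsE.
- exact: setI_closed_cylinder.
- by move=> _; right; exists [::] => //; exact: cylinder0.
- by rewrite bigcup_const.
- move=> _ [->|[t _ <-]]; first by rewrite !measure0.
  rewrite /mu1 /mu2 /= /mscale /= /branch !fine_probability//.
  case: t => [|z v]; first by rewrite cylinder0 !preimage_setT !setIT muleC.
  rewrite !cylinder_shift -xsyu; case: eqP => [_|_]; last by rewrite measure0 !mule0.
  by rewrite !cylinder_weight -xsyu muleCA.
- move=> _; rewrite /mu1 /= /mscale /= /branch preimage_setT setIT.
  by rewrite -[X in _ * X]fine_probability// -EFinM ltry.
Qed.

(* By the Markov property the set below is never empty; it is all of R when no
   cylinder ending at [i] has positive probability. *)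
Definition future_prob E i : R := xget 0%R [set r : R |
  forall x s, last x s = i ->
  Q (cylinder (x :: s) `&` shift (size s) @^-1` E) = Q (cylinder (x :: s)) * r%:E].

Lemma future_probE E x s : measurable E ->
  Q (cylinder (x :: s) `&` shift (size s) @^-1` E) =
  Q (cylinder (x :: s)) * (future_prob E (last x s))%:E.
Proof.
move=> mE; rewrite /future_prob; case: xgetP => [r _ ->//|].
have mC t : measurable (@cylinder S s0 t) by exact: measurable_cylinder.
have mCE t n : measurable (cylinder t `&` shift n @^-1` E).
  by apply: measurableI => //; exact: measurable_shift_preimage.
have fE A : measurable A -> Q A = (fine (Q A))%:E.
  by move=> mA; rewrite fine_probability.
have [[y [u [yu Qyu]]]|none] := pselect (exists y u,
    last y u = last x s /\ Q (cylinder (y :: u)) != 0).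
  move=> /(_ (fine (Q (cylinder (y :: u) `&` shift (size u) @^-1` E))
              / fine (Q (cylinder (y :: u))))%R)[].
  move=> z v zv; have := markov_property mE (etrans zv (esym yu)).
  rewrite (fE _ (mCE (z :: v) _)) (fE _ (mCE (y :: u) _)).
  rewrite (fE _ (mC (y :: u))) (fE _ (mC (z :: v))) /=.
  rewrite -!EFinM => -[eqE]; congr EFin.
  have fyu : fine (Q (cylinder (y :: u))) != 0%R.
    by rewrite -eqe fine_probability.
  by apply: (mulIf fyu); rewrite eqE -mulrA divfK// mulrC.
move=> /(_ 0%R)[] z v zv; rewrite mule0.
have Qzv : Q (cylinder (z :: v)) = 0.
  by apply/eqP; apply: contrapT => /negP Qzv; apply: none; exists z, v.
exact: subset_measure0 (@subIsetl _ _ _) Qzv.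
Qed.

Lemma negligible_future E i x s : measurable E -> last x s = i ->
    Q (cylinder (x :: s)) != 0 ->
  (future_prob E i = 0)%R <->
  Q.-negligible (cylinder (x :: s) `&` shift (size s) @^-1` E).
Proof.
move=> mE xs Qxs; have mC : measurable (cylinder (x :: s) `&` shift (size s) @^-1` E).
  by apply: measurableI; [exact: measurable_cylinder|exact: measurable_shift_preimage].
apply: iff_trans (iff_sym (negligibleP Q mC)).
have := future_probE x s mE; rewrite xs => fE; split=> [f0|/(etrans (esym fE))/eqP].
  by apply: (etrans fE); rewrite f0 mule0.
by rewrite mule_eq0 (negbTE Qxs) => /eqP[].
Qed.

(* A Levy 0-1 law: decomposing [F], which depends on the first [n] coordinates,
   along the first visit to [D] after time [n] gives Q (F & G) <= Q F / 2; then
   approximate [G] itself by such an [F]. *)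
Lemma levy_null m (D : set S) G : (0 < m)%N -> measurable G ->
    shift m @^-1` G = G ->
    (forall w, G w -> forall N, exists2 n, (N <= n)%N & D (w (n * m)%N)) ->
    (forall x s, D (last x s) -> Q (cylinder (x :: s) `&` shift (size s) @^-1` G) <=
       (2^-1)%:E * Q (cylinder (x :: s))) ->
  Q.-negligible G.
Proof.
move=> m0 mG shiftG GD Gle.
have shiftGk k : shift (k * m) @^-1` G = G.
  elim: k => [|k IHk]; first by rewrite mul0n preimage_shift0.
  by rewrite mulSn preimage_shiftD shiftG.
have half0 : (0 <= 2^-1 :> R)%R by rewrite invr_ge0.
pose mu : {measure set _ -> \bar R} := mrestr Q mG.
pose nu : {measure set _ -> \bar R} := mscale (NngNum half0) Q.
have stopped k F : prefix_event (k * m).+1 F -> (forall w, F w -> D (w (k * m)%N)) ->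
    Q (F `&` G) <= (2^-1)%:E * Q F.
  move=> Fk FD; rewrite (prefix_eventE Fk).
  suff : mu (\bigcup_t prefix_cylinder (k * m).+1 F t) <=
         nu (\bigcup_t prefix_cylinder (k * m).+1 F t) by [].
  apply: le_measure_countable_partition.
  - by move=> t; exact: measurable_prefix_cylinder.
  - exact: trivIset_prefix_cylinder.
  - move=> t; rewrite /prefix_cylinder; case: ifPn; last by rewrite !measure0.
    case: t => // x s /andP[/eqP[sk] /asboolP[w [wxs Fw]]].
    (* On a cylinder ending at time [k * m], invariance turns [G] into an event of the future from
       that time, to which [Gle] applies. *)
    rewrite /mu /nu /= /mrestr /mscale /= -{1}(shiftGk k) -sk; apply: Gle.
    by rewrite -(last_cylinder wxs) sk; exact: FD.
have prefix n F : prefix_event n F -> Q (F `&` G) <= (2^-1)%:E * Q F.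
  move=> Fn.
  (* Here [n] bounds both the coordinates read by [F] and the steps of the m-step chain that are
     skipped; since [n <= k <= k * m], the first [k * m + 1] coordinates determine [A k]. *)
  pose A k := F `&` [set w | [/\ (n <= k)%N, D (w (k * m)%N) &
    forall j, (n <= j < k)%N -> ~ D (w (j * m)%N)]].
  have Apre k : prefix_event (k * m).+1 (A k).
    have [nk|kn] := leqP n k; last by move=> ? ? _ [_ []]; rewrite leqNgt kn.
    apply: prefix_eventI.
      by apply: prefix_event_le Fn; rewrite (leq_trans nk)// ltnW// ltnS leq_pmulr.
    move=> w w' ww' [_ Dw nDw]; split=> //; first by rewrite -ww'.
    move=> j /[dup] njk /nDw; rewrite ww'// ltnS leq_pmul2r//.
    by case/andP : njk => _ /ltnW.
  have mA k : measurable (A k) := measurable_prefix_event (Apre k).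
  have mF : measurable F := measurable_prefix_event Fn.
  have mUA : measurable (\bigcup_k A k) by exact: bigcupT_measurable.
  have UAF : \bigcup_k A k `<=` F by move=> w [k _ []].
  have FGA : F `&` G `<=` \bigcup_k A k `&` G.
    move=> w [Fw Gw]; split=> //.
    have exD : exists k, (n <= k)%N && `[< D (w (k * m)%N) >].
      by have [k nk Dk] := GD w Gw n; exists k; rewrite nk asboolT.
    case: (ex_minnP exD) => k /andP[nk /asboolP Dk] kmin.
    exists k => //; split=> //; split=> // j /andP[nj jk] Dj.
    by have := kmin j; rewrite nj asboolT//= leqNgt jk => /(_ isT).
  apply: (@le_trans _ _ (mu (\bigcup_k A k))).
    by apply: le_measure FGA; rewrite inE; exact: measurableI.
  apply: (@le_trans _ _ (nu (\bigcup_k A k))); last first.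
    by rewrite /nu /= /mscale lee_pmul// le_measure ?inE.
  apply: le_measure_countable_partition => //.
    move=> i j _ _ [w [[_ [ni Di nDi]] [_ [nj Dj nDj]]]].
    have [ij|ji|//] := ltngtP i j; first by case: (nDj i); rewrite ?ni.
    by case: (nDi j); rewrite ?nj.
  move=> k; rewrite /mu /nu /= /mrestr /mscale/=; apply: stopped => //.
  by move=> w [_ []].
suff : Q G <= 0 by rewrite measure_le0 => /eqP QG0; apply/negligibleP.
rewrite -fine_probability// lee_fin; apply/ler_addgt0Pl => e e0; rewrite addr0.
(* [Q (F & G) <= Q F / 2] amounts to [Q (F & G) <= Q (F \ G)], so both parts of [Q G], inside and
   outside [F], are below [e / 3]. *)
have e3 : (0 < e / 3)%R by rewrite divr_gt0.
have [n [F [Fn GF FG]]] := prefix_approximation Q mG e3.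
have mF := measurable_prefix_event Fn.
have FE : Q F = Q (F `\` G) + Q (F `&` G) by exact: measureDI.
have GE : Q G = Q (G `\` F) + Q (F `&` G) by rewrite setIC; exact: measureDI.
have fE A : measurable A -> Q A = (fine (Q A))%:E.
  by move=> mA; rewrite fine_probability.
have mFG := measurableI _ _ mF mG.
have mFdG := measurableD mF mG; have mGdF := measurableD mG mF.
move: (prefix n F Fn) FE GE GF FG.
rewrite (fE _ mG) (fE _ mF) (fE _ mFG) (fE _ mFdG) (fE _ mGdF).
rewrite -EFinM -!EFinD !lte_fin lee_fin /= => FGle [FE] [GE] GF FG.
have := fine_ge0 (measure_ge0 Q G).
by lra.
Qed.

End markov_property.

(** * Invariant events and the sets of states that represent them *)

Section invariant_events.
Local Open Scope ereal_scope.
Context (R : realType) (S : countType) (s0 : S).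
Variables (Q : probability (paths s0) R) (p : S -> S -> R).
Implicit Types (E F G : set (paths s0)) (w : paths s0) (C D : set S).

Definition coordinate (n : nat) w : S := w n.

Local Notation io m C := (io_event (mstep coordinate m) C).
Local Notation ult m C := (ult_event (mstep coordinate m) C).
Local Notation null E := (Q.-negligible E).

(** Invariance is exact, not almost sure: the events [io] and [ult] satisfy it literally, and set
    operations and shifts preserve it. *)
Definition invariant m E := measurable E /\ shift m @^-1` E = E.

Lemma invariant_setC m E : invariant m E -> invariant m (~` E).
Proof. by case=> mE sE; split; [exact: measurableC|rewrite -preimage_setC sE]. Qed.

Lemma invariant_setI m E F : invariant m E -> invariant m F -> invariant m (E `&` F).
Proof.
by case=> mE sE [mF sF]; split; [exact: measurableI|rewrite preimage_setI sE sF].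
Qed.

Lemma invariant_setD m E F : invariant m E -> invariant m F -> invariant m (E `\` F).
Proof. by move=> iE iF; apply: invariant_setI => //; exact: invariant_setC. Qed.

Lemma invariant_setT m : invariant m setT.
Proof. by split. Qed.

Lemma invariant_mulr m k E : invariant m E -> invariant (k * m) E.
Proof.
case=> mE sE; split=> //; elim: k => [|k IHk]; first by rewrite mul0n preimage_shift0.
by rewrite mulSn preimage_shiftD sE.
Qed.

Lemma invariant_dvdn m n E : (m %| n)%N -> invariant m E -> invariant n E.
Proof. by move=> /dvdnP[k ->]; exact: invariant_mulr. Qed.

Lemma invariant_shift m r E : invariant m E -> invariant m (shift r @^-1` E).
Proof.
case=> mE sE; split; first exact: measurable_shift_preimage.
by rewrite -preimage_shiftD addnC preimage_shiftD sE.
Qed.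

Lemma measurable_io m C : measurable (io m C).
Proof.
have -> : io m C = \bigcap_N \bigcup_n
    (if (N <= n)%N then [set w : paths s0 | C (w (n * m)%N)] else set0).
  apply/seteqP; split=> w ioC N; last first.
    by have [n _] := ioC N Logic.I; case: ifP => // Nn Cn; exists n.
  by move=> _; have [n Nn Cn] := ioC N; exists n; rewrite ?Nn.
apply: bigcapT_measurable => N; apply: bigcupT_measurable => n.
by case: ifP => // _; exact: measurable_coordinate.
Qed.

Lemma ult_setC m C : ult m (~` C) = ~` io m C.
Proof.
apply/seteqP; split=> w.
  by move=> [N nC] /(_ N)[n Nn Cn]; exact: nC Cn.
move=> nio; apply: contrapT => nult; apply: nio => N.
apply: contrapT => nC; apply: nult; exists N => n Nn Cn.
by apply: nC; exists n.
Qed.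

Lemma io_setC m C : io m (~` C) = ~` ult m C.
Proof. by rewrite -[in RHS](setCK C) ult_setC setCK. Qed.

Lemma ult_setI m C D : ult m (C `&` D) = ult m C `&` ult m D.
Proof.
apply/seteqP; split=> w.
  by move=> [N CD]; split; exists N => n /CD[].
move=> [[N CN] [K DK]]; exists (maxn N K) => n; rewrite geq_max => /andP[Nn Kn].
by split; [exact: CN|exact: DK].
Qed.

Lemma ult_subset m C D : C `<=` D -> ult m C `<=` ult m D.
Proof. by move=> CD w [N CN]; exists N => n /CN /CD. Qed.

Lemma io_subset m C D : C `<=` D -> io m C `<=` io m D.
Proof. by move=> CD w ioC N; have [n Nn /CD] := ioC N; exists n. Qed.

Lemma ult_io m C : ult m C `<=` io m C.
Proof. by move=> w [N CN] K; exists (maxn N K); [exact: leq_maxr|exact/CN/leq_maxl]. Qed.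

Lemma ult_mstep m C : (0 < m)%N -> ult 1 C `<=` ult m C.
Proof.
move=> m0 w [N CN]; exists N => n Nn; rewrite /mstep /coordinate.
have := CN (n * m)%N; rewrite /mstep /coordinate muln1; apply.
by rewrite (leq_trans Nn)// leq_pmulr.
Qed.

Lemma io_mstep m C : (0 < m)%N -> io m C `<=` io 1 C.
Proof.
move=> m0 w ioC N; have [n Nn Cn] := ioC N; exists (n * m)%N.
  by rewrite (leq_trans Nn)// leq_pmulr.
by rewrite /mstep muln1.
Qed.

Lemma invariant_io m C : invariant m (io m C).
Proof.
split; first exact: measurable_io.
apply/seteqP; split=> w /= ioC N.
  have [n Nn Cn] := ioC N; exists n.+1; first exact: leqW.
  by rewrite /mstep /coordinate mulSnr.
have [[//|n] Nn Cn] := ioC N.+1; exists n => //.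
by move: Cn; rewrite /mstep /coordinate mulSnr.
Qed.

Lemma invariant_ult m C : invariant m (ult m C).
Proof. by rewrite -(setCK C) ult_setC; exact/invariant_setC/invariant_io. Qed.

(** Stated with [negligible], which passes to arbitrary subsets without measurability conditions. *)
Definition regular_set C m := null (io m C `\` ult m C).

Lemma regularE m C : regular Q (mstep coordinate m) C <-> regular_set C m.
Proof.
have [mD _] := invariant_setD (invariant_io m C) (invariant_ult m C).
by split=> [/(negligibleP _ mD)|/(negligibleP _ mD)].
Qed.

Lemma transientE m C : transient Q (mstep coordinate m) C <-> null (io m C).
Proof. by apply: iff_sym; apply: negligibleP; exact: measurable_io. Qed.

(** For a regular set the two events differ by a null event, so non-transience can be tested on
    [ult]. *)
Lemma almost_closedE m C : almost_closed Q (mstep coordinate m) C <->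
  regular_set C m /\ ~ null (ult m C).
Proof.
split=> [[/regularE rC nt]|[rC nu]]; split=> //.
- move=> nu; apply/nt/transientE; apply: negligibleS (negligibleU rC nu) => w ioC.
  by have [?|?] := pselect (ult m C w); [right|left].
- exact/regularE.
- by move=> /transientE; apply: contra_not nu; apply: negligibleS; exact: ult_io.
Qed.

Lemma regular_setC m C : regular_set C m -> regular_set (~` C) m.
Proof.
rewrite /regular_set io_setC ult_setC; apply: negligibleS => w [nu io].
by split=> //; exact: contrapT.
Qed.

Lemma regular_setI m C D : regular_set C m -> regular_set D m -> regular_set (C `&` D) m.
Proof.
move=> rC rD; apply: negligibleS (negligibleU rC rD) => w [ioCD].
rewrite ult_setI => nu; have ioC := io_subset (@subIsetl _ C D) ioCD.
have ioD := io_subset (@subIsetr _ C D) ioCD.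
by have [?|?] := pselect (ult m C w); [right; split=> // ?; exact: nu|left].
Qed.

Hypothesis Q_markov : markov_law Q p.
(** The one form in which irreducibility and aperiodicity enter the study of invariant events;
    [reach_at_multiple] provides it. *)
Hypothesis Q_reach : forall m i, (0 < m)%N -> exists x s,
  [/\ (m %| size s)%N, last x s = i & Q (cylinder (x :: s)) != 0].

(** At a time divisible by [m] at which [i] is reached with positive probability, invariance
    identifies [E] with its own future version, so nullity is inherited from that state on. *)
Lemma null_future_prob m E i : (0 < m)%N -> invariant m E -> null E ->
  future_prob Q E i = 0%R.
Proof.
move=> m0 iE nE; have [x [s [ms <- Qxs]]] := Q_reach i m0.
apply: (iffRL (negligible_future Q_markov iE.1 erefl Qxs)).
have [_ ->] := invariant_dvdn ms iE.
by apply: negligibleS nE; exact: subIsetr.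
Qed.

(** Condition on the first [r.+1] coordinates, which fix the state at time [r]: from every state the
    conditional probability of [E] is 0. *)
Lemma null_shift m r E : (0 < m)%N -> invariant m E -> null E -> null (shift r @^-1` E).
Proof.
move=> m0 iE nE.
pose V t := prefix_cylinder r.+1 setT t `&` shift r @^-1` E.
have mE := iE.1; have mrE := measurable_shift_preimage r mE.
have mV t : measurable (V t).
  by apply: measurableI => //; exact: measurable_prefix_cylinder.
have : null (\bigcup_t V t); last first.
  apply: negligibleS => w Ew; exists (mkseq w r.+1) => //; split=> //.
  rewrite /prefix_cylinder size_mkseq eqxx asboolT; first exact: cylinder_mkseq.
  by exists w; split=> //; exact: cylinder_mkseq.
apply: negligible_countType_bigcup => // t; rewrite /V /prefix_cylinder.
case: ifP => [|_]; last by rewrite set0I; exact: negligible_set0.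
case: t => // x s /andP[/eqP[<-] _]; apply/negligibleP.
  by apply: measurableI; [exact: measurable_cylinder|exact: measurable_shift_preimage].
have := future_probE Q_markov x s mE.
by rewrite (null_future_prob _ m0 iE nE) mule0.
Qed.

Lemma null_shiftE m r E : (0 < m)%N -> invariant m E -> null (shift r @^-1` E) <-> null E.
Proof.
move=> m0 iE; split; last exact: null_shift iE.
(* A further shift by [m.-1 * r] brings the total to [r * m], under which [E] is invariant: shifts
   are invertible on m-invariant events. *)
move=> /(null_shift (m.-1 * r) m0 (invariant_shift r iE)).
rewrite -preimage_shiftD -mulSn prednK// mulnC.
by have [_ ->] := invariant_mulr r iE.
Qed.

(** The states representing [E]: almost surely, the m-step chain stays in this set ultimately on [E]
    and visits it finitely often off [E]. *)
Definition majority E : set S := [set i | (2^-1 < future_prob Q E i)%R].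

(** At each visit to [majority E] the complement of [E] has conditional probability below 1/2, so
    [levy_null] applies; the companion statement uses visits to the complement of [majority E]. *)
Lemma null_io_majority m E : (0 < m)%N -> invariant m E ->
  null (io m (majority E) `\` E).
Proof.
move=> m0 iE; have iD := invariant_setD (invariant_io m (majority E)) iE.
apply: (levy_null (D := majority E) m0 iD.1 iD.2) => [w [ioE _]//|x s Es].
have mC : measurable (@cylinder S s0 (x :: s)) by exact: measurable_cylinder.
have mE := measurable_shift_preimage (size s) iE.1.
apply: (@le_trans _ _ (Q (cylinder (x :: s) `\` shift (size s) @^-1` E))).
  apply: le_measure; rewrite ?inE; [|exact: measurableD|by move=> w [? [_ nE]]; split].
  by apply: measurableI => //; exact: measurable_shift_preimage iD.1.
have -> : Q (cylinder (x :: s) `\` shift (size s) @^-1` E) =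
    Q (cylinder (x :: s)) - Q (cylinder (x :: s)) * (future_prob Q E (last x s))%:E.
  rewrite -(future_probE Q_markov x s iE.1); apply: measureD => //.
  by rewrite -ge0_fin_numE// fin_num_measure.
rewrite -fine_probability// -!EFinM -EFinB lee_fin.
have := fine_ge0 (measure_ge0 Q (cylinder (x :: s))); move: Es; rewrite /majority/=.
set a := fine _; set h := future_prob _ _ _ => h2 a0; nra.
Qed.

Lemma null_setD_ult_majority m E : (0 < m)%N -> invariant m E ->
  null (E `\` ult m (majority E)).
Proof.
move=> m0 iE; have iD := invariant_setD iE (invariant_ult m (majority E)).
apply: (levy_null (D := ~` majority E) m0 iD.1 iD.2) => [w [_]|x s Es].
  by rewrite -[ult _ _]setCK -io_setC => /contrapT.
have mC : measurable (@cylinder S s0 (x :: s)) by exact: measurable_cylinder.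
have mE := measurable_shift_preimage (size s) iE.1.
apply: (@le_trans _ _ (Q (cylinder (x :: s) `&` shift (size s) @^-1` E))).
  apply: le_measure; rewrite ?inE; [|exact: measurableI|by move=> w [? [? _]]; split].
  by apply: measurableI => //; exact: measurable_shift_preimage iD.1.
rewrite (future_probE Q_markov x s iE.1).
rewrite -fine_probability// -!EFinM lee_fin.
have := fine_ge0 (measure_ge0 Q (cylinder (x :: s))).
have {}Es : (future_prob Q E (last x s) <= 2^-1)%R by rewrite leNgt; apply/negP.
by move=> ?; rewrite mulrC ler_wpM2r.
Qed.

Lemma regular_majority m E : (0 < m)%N -> invariant m E -> regular_set (majority E) m.
Proof.
move=> m0 iE; apply: negligibleS
  (negligibleU (null_io_majority m0 iE) (null_setD_ult_majority m0 iE)) => w [ioE nu].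
by have [?|?] := pselect (E w); [right|left].
Qed.

Definition invariant_atom m E := [/\ invariant m E, ~ null E &
  forall F, invariant m F -> null (E `&` F) \/ null (E `\` F)].

(** An invariant event splitting [ult m C] yields two disjoint almost closed subsets by cutting [C]
    along its majority set. Conversely, of two disjoint subsets of [C], an atom leaves one with a
    null [ult] event. *)
Lemma atomicE m C : (0 < m)%N -> atomic Q (mstep coordinate m) C <->
  regular_set C m /\ invariant_atom m (ult m C).
Proof.
move=> m0; split.
  case=> /almost_closedE[rC nC] natC; split=> //; split=> // [|F iF].
    exact: invariant_ult.
  apply: contrapT => /not_orP[nCF nCdF].
  have rF := regular_majority m0 iF.
  apply: natC; exists (C `&` majority F), (C `&` ~` majority F); split.
  - exact: subIsetl.
  - exact: subIsetl.
  - by rewrite setIACA setICr setI0.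
  - apply/almost_closedE; split; first exact: regular_setI.
    apply: contra_not nCF; rewrite ult_setI => nCM.
    apply: negligibleS (negligibleU nCM (null_setD_ult_majority m0 iF)) => w [Cw Fw].
    by have [?|?] := pselect (ult m (majority F) w); [left|right].
  - apply/almost_closedE; split; first exact/regular_setI/regular_setC.
    apply: contra_not nCdF; rewrite ult_setI ult_setC => nCM.
    apply: negligibleS (negligibleU nCM (null_io_majority m0 iF)) => w [Cw Fw].
    by have [?|?] := pselect (io m (majority F) w); [right|left].
case=> rC [_ nC atC]; split; first exact/almost_closedE.
move=> [A [B [AC BC AB0 /almost_closedE[_ nA] /almost_closedE[_ nB]]]].
case: (atC _ (invariant_ult m A)) => [CA|CA].
  apply: nA; apply: negligibleS CA => w Aw; split=> //; exact: ult_subset Aw.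
apply: nB; apply: negligibleS CA => w Bw; split; first exact: ult_subset Bw.
move=> Aw; have : ult m (A `&` B) w by rewrite ult_setI.
by rewrite AB0 => -[N /(_ N (leqnn N))].
Qed.

End invariant_events.

Lemma preimage_setD aT rT (f : aT -> rT) (A B : set rT) :
  f @^-1` (A `\` B) = f @^-1` A `\` f @^-1` B.
Proof. by []. Qed.

(** * Atoms of the invariant events under the shift *)

Section atoms.
Local Open Scope ereal_scope.
Context (R : realType) (S : countType) (s0 : S).
Variables (Q : probability (paths s0) R) (p : S -> S -> R).
Hypothesis Q_markov : markov_law Q p.
Hypothesis Q_reach : forall m i, (0 < m)%N -> exists x s,
  [/\ (m %| size s)%N, last x s = i & Q (cylinder (x :: s)) != 0].
Implicit Types (A E F : set (paths s0)) (w : paths s0) (C : set S).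

Local Notation chain m := (mstep (@coordinate S s0) m).
Local Notation io m C := (io_event (chain m) C).
Local Notation ult m C := (ult_event (chain m) C).
Local Notation null E := (Q.-negligible E).

(** For an m-invariant [A] only the residues of [j * k] modulo [m] matter, so that this is in effect
    a finite union. *)
Definition orbit k A := \bigcup_j shift (j * k) @^-1` A.

Lemma sub_orbit k A : A `<=` orbit k A.
Proof. by move=> w Aw; exists 0%N => //; rewrite mul0n preimage_shift0. Qed.

Lemma shift_modn m r A : invariant m A -> shift (r %% m) @^-1` A = shift r @^-1` A.
Proof.
move=> iA; rewrite [in RHS](divn_eq r m) preimage_shiftD.
by have [_ ->] := invariant_mulr (r %/ m) iA.
Qed.

Lemma invariant_orbit m k A : (0 < m)%N -> invariant m A -> invariant k (orbit k A).
Proof.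
move=> m0 iA; split.
  by apply: bigcupT_measurable => j; exact: measurable_shift_preimage iA.1.
have shE j : shift k @^-1` (shift (j * k) @^-1` A) = shift (j.+1 * k) @^-1` A.
  by rewrite -preimage_shiftD mulSnr.
rewrite /orbit preimage_bigcup; apply/seteqP; split=> w [j _].
  by rewrite shE => Aw; exists j.+1.
(* Shifting loses the term of index 0; it comes back as the term of index [m], since [A] is
   invariant under the shift by [m * k]. *)
case: j => [|j] Aw; last by exists j => //; rewrite shE.
exists m.-1 => //; rewrite shE prednK//; move: Aw; rewrite mul0n preimage_shift0.
by rewrite mulnC; have [_ ->] := invariant_mulr k iA.
Qed.

Lemma orbit1E m A : (0 < m)%N -> invariant m A ->
  orbit 1 A `<=` \big[setU/set0]_(r < m) shift r @^-1` A.
Proof.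
move=> m0 iA w [j _]; rewrite muln1 -(shift_modn j iA) => Aw.
rewrite -(bigcup_mkord m (fun r => shift r @^-1` A)).
by exists (j %% m)%N => //=; rewrite ltn_mod.
Qed.

Lemma invariant_atom_equiv m A E : invariant_atom Q m A -> invariant m E ->
  null (A `\` E) -> null (E `\` A) -> invariant_atom Q m E.
Proof.
move=> [iA nA atA] iE AE EA; split=> // [nE|F iF].
  by apply: nA; apply: negligibleS (negligibleU nE AE) => w Aw;
     have [?|?] := pselect (E w); [left|right].
have [AF|AF] := atA F iF; [left|right].
  apply: negligibleS (negligibleU AF EA) => w [Ew Fw].
  by have [?|?] := pselect (A w); [left|right].
apply: negligibleS (negligibleU AF EA) => w [Ew Fw].
by have [?|?] := pselect (A w); [left|right].
Qed.

(** Preimage by [shift r] is an automorphism of the m-invariant events that respects null events;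
    its inverse is preimage by [shift (m.-1 * r)]. *)
Lemma invariant_atom_shift m r A : (0 < m)%N ->
  invariant_atom Q m A -> invariant_atom Q m (shift r @^-1` A).
Proof.
move=> m0 [iA nA atA]; split.
- exact: invariant_shift.
- by move=> /(null_shiftE Q_markov Q_reach r m0 iA).
- move=> F iF; pose F' := shift (m.-1 * r) @^-1` F.
  have iF' : invariant m F' by exact: invariant_shift.
  have FF' : shift r @^-1` F' = F.
    rewrite /F' -preimage_shiftD -mulSnr prednK// mulnC.
    by have [_ ->] := invariant_mulr r iF.
  have [AF|AF] := atA F' iF'; [left|right].
    have := null_shift Q_markov Q_reach r m0 (invariant_setI iA iF') AF.
    by rewrite preimage_setI FF'.
  have := null_shift Q_markov Q_reach r m0 (invariant_setD iA iF') AF.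
  by rewrite preimage_setD FF'.
Qed.

(** A k-invariant [F] almost contains or almost misses [A]; as [F] is fixed by the shifts that form
    the orbit, the same alternative holds for every copy of [A]. *)
Lemma invariant_atom_orbit m k A : (0 < m)%N -> (k %| m)%N ->
  invariant_atom Q m A -> invariant_atom Q k (orbit k A).
Proof.
move=> m0 km [iA nA atA]; split.
- exact: invariant_orbit iA.
- by apply: contra_not nA; apply: negligibleS; exact: sub_orbit.
- move=> F iF; have iFm := invariant_dvdn km iF.
  have FE j : shift (j * k) @^-1` F = F by have [_ ->] := invariant_mulr j iF.
  have [AF|AF] := atA F iFm; [left|right].
    rewrite setI_bigcupl; apply: negligible_bigcup => j; rewrite -(FE j) -preimage_setI.
    exact: (null_shift Q_markov Q_reach _ m0 (invariant_setI iA iFm) AF).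
  rewrite setD_bigcupl; apply: negligible_bigcup => j; rewrite -(FE j) -preimage_setD.
  exact: (null_shift Q_markov Q_reach _ m0 (invariant_setD iA iFm) AF).
Qed.

(** Places an atomic set inside a prescribed [C]: its [ult] event agrees with [A] up to a null
    event. *)
Lemma atomic_setI_majority m C A : (0 < m)%N -> regular_set Q C m ->
    invariant_atom Q m A -> null (A `\` ult m C) ->
  atomic Q (chain m) (C `&` majority Q A).
Proof.
move=> m0 rC atA AC; have [iA _ _] := atA.
apply/(atomicE Q_markov _ m0); split.
  by apply: regular_setI => //; exact: regular_majority.
rewrite ult_setI; apply: (invariant_atom_equiv atA).
- by apply: invariant_setI; exact: invariant_ult.
- have AM := null_setD_ult_majority Q_markov m0 iA.
  apply: negligibleS (negligibleU AC AM) => w [Aw nCM].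
  have [Cw|?] := pselect (ult m C w); last by left.
  by right; split=> // Mw; apply: nCM.
- apply: negligibleS (null_io_majority Q_markov m0 iA) => w [[_ Mw] nA].
  by split=> //; exact: ult_io.
Qed.

Lemma ult_setT m : ult m setT = setT.
Proof. by apply/seteqP; split=> // w _; exists 0%N. Qed.

Lemma regular_setT m : regular_set Q setT m.
Proof. by rewrite /regular_set ult_setT setDT; exact: negligible_set0. Qed.

Lemma atomic_majority m A : (0 < m)%N ->
  invariant_atom Q m A -> atomic Q (chain m) (majority Q A).
Proof.
move=> m0 atA; rewrite -[majority _ _]setTI; apply: atomic_setI_majority => //.
  exact: regular_setT.
by rewrite ult_setT setDT; exact: negligible_set0.
Qed.

(** From a common state, reached with positive probability at a multiple of [m], two almost disjoint
    events would have conditional probabilities adding up to more than 1. *)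
Lemma majority_disjoint m E F : (0 < m)%N -> invariant m E -> invariant m F ->
  null (E `&` F) -> majority Q E `&` majority Q F = set0.
Proof.
move=> m0 iE iF EF; apply/seteqP; split=> // i [/= Ei Fi].
have [x [s [ms xi Qxs]]] := Q_reach i m0.
have [_ sE] := invariant_dvdn ms iE; have [_ sF] := invariant_dvdn ms iF.
have mC : measurable (@cylinder S s0 (x :: s)) by exact: measurable_cylinder.
have hE := future_probE Q_markov x s iE.1.
have hF := future_probE Q_markov x s iF.1.
rewrite sE xi in hE; rewrite sF xi in hF.
have mCE := measurableI _ _ mC iE.1; have mCF := measurableI _ _ mC iF.1.
have QC : Q (cylinder (x :: s)) =
    Q (cylinder (x :: s) `\` E) + Q (cylinder (x :: s) `&` E).
  by apply: measureDI => //; exact: iE.1.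
have CF : Q (cylinder (x :: s) `&` F) <= Q (cylinder (x :: s) `\` E).
  have -> : Q (cylinder (x :: s) `&` F) = Q (cylinder (x :: s) `&` F `\` E).
    rewrite [LHS](measureDI _ mCF iE.1) [X in _ + X]measure_negligible ?adde0//.
      by apply: measurableI => //; exact: iE.1.
    by apply: negligibleS EF => w [[_ ?] ?].
  apply: le_measure; rewrite ?inE; last by move=> w [[]].
    by apply: measurableD => //; exact: iE.1.
  by apply: measurableD => //; exact: iE.1.
have mCdE := measurableD mC iE.1.
have fE A : measurable A -> Q A = (fine (Q A))%:E.
  by move=> mA; rewrite fine_probability.
move: CF; rewrite hF; move: QC; rewrite hE.
rewrite (fE _ mCdE) (fE _ mC) -!EFinM -EFinD lee_fin => -[QC] CF.
have Q0 : (0 < fine (Q (cylinder (x :: s))))%R.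
  by rewrite lt0r fine_ge0 ?measure_ge0// andbT -eqe fine_probability.
by move: Ei Fi QC CF Q0; rewrite /majority /=; set a := fine _; set b := fine _;
   set e := future_prob _ _ _; set f := future_prob _ _ _; nra.
Qed.

Lemma no_invariant_atom m C A : (0 < m)%N -> almost_closed Q (chain 1) C ->
    null (~` ult 1 C) -> (forall B, B `<=` C -> ~ atomic Q (chain 1) B) ->
  ~ invariant_atom Q m A.
Proof.
move=> m0 /almost_closedE[rC _] C1 natC /(invariant_atom_orbit m0 (dvd1n m)) atA.
apply: (natC (C `&` majority Q (orbit 1 A))); first exact: subIsetl.
by apply: atomic_setI_majority => //; apply: negligibleS C1; exact: subDsetr.
Qed.

End atoms.

(** * Counting the sets of a Blackwell decomposition *)

Section counting_sets.
Context (R : realType) (U : choiceType).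

Lemma counting_card_eq (D : set U) n : (D #= `I_n)%card ->
  counting D = n%:R%:E :> \bar R.
Proof.
move=> Dn; rewrite /counting asboolT; last by exists n.
by rewrite (card_fset_set Dn).
Qed.

Lemma counting_eq1 (D : set U) : counting D = 1%:E :> \bar R -> exists x, D = [set x].
Proof.
rewrite /counting; case: asboolP => // finD [/eqP].
rewrite pnatr_eq1 => /finmap.cardfs1P[x Dx]; exists x.
by rewrite -(fset_setK finD) Dx set_fset1.
Qed.

Lemma counting_set1 (x : U) : counting [set x] = 1%:E :> \bar R.
Proof. by rewrite /counting asboolT// fset_set1 finmap.cardfs1. Qed.

End counting_sets.

Section decomposition_count.
Local Open Scope ereal_scope.
Context (R : realType) (S : countType) (s0 : S).
Variables (Q : probability (paths s0) R) (p : S -> S -> R).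
Hypothesis Q_markov : markov_law Q p.
Implicit Types (A E F : set (paths s0)) (w : paths s0) (C : set S).

Local Notation chain m := (mstep (@coordinate S s0) m).
Local Notation io m C := (io_event (chain m) C).
Local Notation ult m C := (ult_event (chain m) C).
Local Notation null E := (Q.-negligible E).

Lemma trivIset_ult m (D : set (set S)) : trivIset D id -> trivIset D (ult_event (chain m)).
Proof.
move=> tD C C' DC DC' [w [[N CN] [K CK]]]; apply: tD => //.
exists (chain m (maxn N K) w).
by split; [exact/CN/leq_maxl|exact/CK/leq_maxr].
Qed.

(** Otherwise the complement of [E] would carry the whole mass 1 of the disjoint events
    [ult m C]. *)
Lemma decomposition_meets m (D : set (set S)) E :
    blackwell_decomposition Q (chain m) D -> measurable E -> ~ null E ->
  exists2 C, D C & ~ null (E `&` ult m C).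
Proof.
move=> bD mE nE; apply: contrapT => none.
have EC C : D C -> null (E `&` ult m C).
  by move=> DC; apply: contrapT => nEC; apply: none; exists C.
have mult C : measurable (ult m C) := (invariant_ult s0 m C).1.
have : 1 <= Q (~` E).
  rewrite -(bd_total bD) /esum; apply: ge_ereal_sup => _ [X [finX XD] <-].
  have mUX : measurable (\bigcup_(C in X) (ult m C `\` E)).
    by apply: fin_bigcup_measurable => // C _; exact: measurableD.
  have -> : \sum_(C \in X) Q (ult m C) = Q (\bigcup_(C in X) (ult m C `\` E)).
    rewrite measure_fin_bigcup//; last by move=> C _; exact: measurableD.
      apply: eq_fsbigr => C /set_mem XC.
      rewrite [LHS](measureDI _ (mult C) mE) [X in _ + X]measure_negligible ?adde0//.
        exact: measurableI.
      by rewrite setIC; exact/EC/XD.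
    move=> C C' XC XC' [w [[Cw _] [C'w _]]].
    by apply: (trivIset_ult (m := m) (bd_disjoint bD) (XD _ XC) (XD _ XC')); exists w; split.
  apply: le_measure; rewrite ?inE//; first exact: measurableC.
  by move=> w [C _ [_ nEw]].
have -> : Q (~` E) = 1 - (fine (Q E))%:E.
  by rewrite fine_probability//; exact: probability_setC.
rewrite -EFinB lee_fin => E0; apply: nE; apply/negligibleP => //.
apply: (etrans (esym (fine_probability Q mE))); congr EFin.
by have := fine_ge0 (measure_ge0 Q E); lra.
Qed.

(** [beta] counts a decomposition selected by choice, so its value is known only once all
    decompositions are shown to have equally many sets. *)
Lemma beta_decomposition m (D : set (set S)) : blackwell_decomposition Q (chain m) D ->
    (forall D', blackwell_decomposition Q (chain m) D' ->
       counting D' = counting D :> \bar R) ->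
  beta Q (chain m) = counting D.
Proof. by move=> bD cD; rewrite /beta; case: xgetP => [D' _ /cD//|/(_ D)]. Qed.

Section atomic_decomposition.
Variables (m q : nat) (B : nat -> set S).
Hypothesis m_gt0 : (0 < m)%N.
Hypothesis B_atomic : forall r, (r < q)%N -> atomic Q (chain m) (B r).
Hypothesis B_disjoint : trivIset `I_q B.
Hypothesis B_cover : null (~` \bigcup_(r in `I_q) ult m (B r)).

Let D := B @` `I_q.

Let mult C : measurable (ult m C).
Proof. by have [] := invariant_ult s0 m C. Qed.

Let B_atom r : (r < q)%N -> regular_set Q (B r) m /\ invariant_atom Q m (ult m (B r)).
Proof. by move=> /B_atomic/(atomicE Q_markov _ m_gt0). Qed.

Let B_inj r s : (r < q)%N -> (s < q)%N -> B r = B s -> r = s.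
Proof.
move=> rq sq Brs; apply: B_disjoint => //; rewrite -Brs setIid.
have [_ [_ nB _]] := B_atom rq; apply/set0P/eqP => B0; apply: nB.
rewrite B0; apply: negligibleS (negligible_set0 Q) => w [N] /(_ N (leqnn N)).
by [].
Qed.

Let card_D : (D #= `I_q)%card.
Proof. by apply: inj_card_eq => r s /set_mem + /set_mem; exact: B_inj. Qed.

Lemma atomic_family_decomposition : blackwell_decomposition Q (chain m) D.
Proof.
have D_atomic C : D C -> atomic Q (chain m) C by move=> [r rq <-]; exact: B_atomic.
split.
- by apply: finite_set_countable; exists q.
- move=> _ _ [r rq <-] [s sq <-] rs; congr B; exact: B_disjoint.
- by move=> C /D_atomic[].
- by move=> C C' /D_atomic atC _ [_ /(_ atC)].
- by move=> C /D_atomic atC [_ /(_ atC)].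
- have tB : trivIset `I_q (fun r => ult m (B r)).
    move=> r s rq sq [w [[N BN] [K BK]]]; apply: B_disjoint => //.
    exists (chain m (maxn N K) w).
    by split; [exact/BN/leq_maxl|exact/BK/leq_maxr].
  rewrite esum_image; last by move=> r s /set_mem + /set_mem; exact: B_inj.
  rewrite esum_fset; [|exact: finite_II|by move=> r _; exact: measure_ge0].
  have mU : measurable (\bigcup_(r in `I_q) ult m (B r)).
    by apply: fin_bigcup_measurable => //; exact: finite_II.
  rewrite -(probability_conegligible mU B_cover).
  by rewrite measure_fin_bigcup//; exact: finite_II.
Qed.

(** In another decomposition, each [ult m (B r)], being an atom, lies almost inside the [ult] event
    of one member. Every member is hit because the atoms cover. A member hit twice would be
    nonatomic, hence without atomic subsets, yet its intersection with [B r] is atomic. *)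
Lemma beta_atomic_family : beta Q (chain m) = q%:R%:E.
Proof.
rewrite -(counting_card_eq R card_D).
apply: beta_decomposition atomic_family_decomposition _ => D' bD'.
rewrite (counting_card_eq R card_D); apply: counting_card_eq.
have meets r : exists C, (r < q)%N -> D' C /\ ~ null (ult m (B r) `&` ult m C).
  have [rq|qr] := ltnP r q; last by exists set0.
  have [_ [_ nB _]] := B_atom rq.
  by have [C D'C nBC] := decomposition_meets bD' (mult (B r)) nB; exists C.
have [f fP] := choice meets.
have sub r C : (r < q)%N -> ~ null (ult m (B r) `&` ult m C) ->
    null (ult m (B r) `\` ult m C).
  move=> rq nBC; have [_ [_ _ atB]] := B_atom rq.
  by case: (atB _ (invariant_ult s0 m C)).
have D'E : D' = f @` `I_q.
  apply/seteqP; split=> [C D'C|_ [r rq <-]]; last by have [] := fP r rq.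
  have [_ nC] := iffLR (almost_closedE _ _ _) (bd_almost_closed bD' D'C).
  have [r rq nBC] : exists2 r, (r < q)%N & ~ null (ult m (B r) `&` ult m C).
    apply: contrapT => none; apply: nC.
    have : null (\bigcup_r (if (r < q)%N then ult m (B r) `&` ult m C else set0)).
      apply: negligible_bigcup => r; case: ifP => [rq|_]; last exact: negligible_set0.
      by apply: contrapT => nBC; apply: none; exists r.
    move=> /(negligibleU B_cover); apply: negligibleS => w Cw.
    have [[r rq Bw]|?] := pselect ((\bigcup_(r in `I_q) ult m (B r)) w); last by left.
    by right; exists r; rewrite // ifT.
  exists r => //; have [D'f nBf] := fP r rq; apply: contrapT => fC.
  have [_ [_ nB _]] := B_atom rq; apply: nB.
  apply: negligibleS (negligibleU (sub _ _ rq nBC) (sub _ _ rq nBf)) => w Bw.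
  have [Cw|?] := pselect (ult m C w); last by left.
  right; split=> // fw; apply: fC.
  by apply: (trivIset_ult (m := m) (bd_disjoint bD') D'f D'C); exists w; split.
rewrite D'E; apply: inj_card_eq => r s /set_mem rq /set_mem sq frs.
apply: contrapT => rs; have [D'C nrC] := fP r rq; have [_ nsC] := fP s sq.
rewrite -frs in nsC; set C := f r in D'C nrC nsC.
have rsub := sub _ _ rq nrC; have ssub := sub _ _ sq nsC.
have [rC nC] := iffLR (almost_closedE _ _ _) (bd_almost_closed bD' D'C).
have [rBr atBr] := B_atom rq; have [_ [_ nBs _]] := B_atom sq.
have nonatC : nonatomic Q (chain m) C.
  split; first exact: (bd_almost_closed bD' D'C).
  move=> /(atomicE Q_markov _ m_gt0)[_ [_ _ /(_ _ (invariant_ult s0 m (B r)))]].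
  case=> [|CB]; first by rewrite setIC.
  apply: nBs; apply: negligibleS (negligibleU CB ssub) => w Bsw.
  have [Cw|?] := pselect (ult m C w); last by right.
  left; split=> // Brw; apply: rs.
  apply: B_disjoint => //; case: Bsw => N BN; case: Brw => K BK.
  exists (chain m (maxn N K) w).
  by split; [exact/BK/leq_maxr|exact/BN/leq_maxl].
have [natC _] := bd_nonatomic bD' D'C nonatC.
apply: (natC (C `&` B r)); first exact: subIsetl.
apply/(atomicE Q_markov _ m_gt0); split; first exact: regular_setI.
apply: invariant_atom_equiv atBr (invariant_ult s0 m _) _ _; rewrite ult_setI.
  by apply: negligibleS rsub => w [Bw nCB]; split=> // Cw; apply: nCB.
by apply: negligibleS (negligible_set0 Q) => w [[]].
Qed.

End atomic_decomposition.

(** Without atoms all members of a decomposition are nonatomic, so there is at most one; total mass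
    1 requires at least one. *)
Lemma beta_nonatomic m C : (0 < m)%N -> almost_closed Q (chain m) C ->
    null (~` ult m C) -> (forall A, ~ invariant_atom Q m A) ->
    (forall i, C i -> transient Q (chain m) [set i]) ->
  beta Q (chain m) = 1.
Proof.
move=> m0 acC C1 natom transC.
have nat B : ~ atomic Q (chain m) B.
  by move=> /(atomicE Q_markov _ m0)[_ /natom].
have bC : blackwell_decomposition Q (chain m) [set C].
  split.
  - exact: finite_set_countable.
  - by move=> ? ? -> ->.
  - by move=> ? ->.
  - by move=> ? ? -> ->.
  - by move=> ? -> _.
  - have mC : measurable (ult m C) := (invariant_ult s0 m C).1.
    by rewrite esum_set1// probability_conegligible.
rewrite (beta_decomposition bC) ?counting_set1// => D' bD'.
have nonat C' : D' C' -> nonatomic Q (chain m) C'.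
  by move=> D'C'; split; [exact: (bd_almost_closed bD' D'C')|exact: nat].
have [C' D'C' _] : exists2 C', D' C' & ~ null (setT `&` ult m C').
  exact: decomposition_meets bD' measurableT (@setT_not_negligible _ _ _ Q).
have -> : D' = [set C'].
  apply/seteqP; split=> [C'' D'C''|_ ->//].
  exact: (bd_nonatomic_uniq bD' D'C'' D'C' (nonat _ D'C'') (nonat _ D'C')).
by rewrite !counting_set1.
Qed.

End decomposition_count.

(** * Cyclic permutation of the atoms when the 1-invariant events are trivial *)

Section cyclic_structure.
Local Open Scope ereal_scope.
Context (R : realType) (S : countType) (s0 : S).
Variables (Q : probability (paths s0) R) (p : S -> S -> R).
Hypothesis Q_markov : markov_law Q p.
Hypothesis Q_reach : forall m i, (0 < m)%N -> exists x s,
  [/\ (m %| size s)%N, last x s = i & Q (cylinder (x :: s)) != 0].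
Implicit Types (A E F : set (paths s0)) (w : paths s0) (C : set S).

Local Notation chain m := (mstep (@coordinate S s0) m).
Local Notation ult m C := (ult_event (chain m) C).
Local Notation null E := (Q.-negligible E).

Hypothesis invariant1_trivial : forall E, invariant 1 E -> null E \/ null (~` E).

Lemma null_orbit1C m E : (0 < m)%N -> invariant m E -> ~ null E -> null (~` orbit 1 E).
Proof.
move=> m0 iE nE; case: (invariant1_trivial (invariant_orbit 1 m0 iE)) => // oE.
by case: nE; apply: negligibleS oE; exact: sub_orbit.
Qed.

(* [shift_mass] is additive on [m]-invariant events, bounded by [m], and at
   least 1 on the non-null ones, whose shifts cover almost all paths: hence
   splitting non-null events must stop at an atom. *)
Definition shift_mass m E := \sum_(r < m) Q (shift r @^-1` E).

Lemma shift_mass_ge1 m E : (0 < m)%N -> invariant m E -> ~ null E ->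
  1 <= shift_mass m E.
Proof.
move=> m0 iE nE; have [mO _] := invariant_orbit 1 m0 iE.
rewrite -(probability_conegligible mO (null_orbit1C m0 iE nE)).
apply: (content_subadditive Q (F := fun r => shift r @^-1` E)) => //; last exact: orbit1E.
by move=> r _; exact: measurable_shift_preimage iE.1.
Qed.

Lemma shift_massDI m E F : invariant m E -> invariant m F ->
  shift_mass m E = shift_mass m (E `\` F) + shift_mass m (E `&` F).
Proof.
move=> [mE _] [mF _]; rewrite /shift_mass -big_split /=; apply: eq_bigr => r _.
by apply: measureDI; exact: measurable_shift_preimage.
Qed.

Lemma exists_invariant_atom m : (0 < m)%N -> exists A, invariant_atom Q m A.
Proof.
move=> m0.
suff atom_below n E : invariant m E -> ~ null E -> shift_mass m E <= n%:R%:E ->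
    exists A, invariant_atom Q m A.
  apply: (atom_below m setT); first exact: invariant_setT.
    exact: setT_not_negligible.
  rewrite /shift_mass.
  under eq_bigr do rewrite preimage_setT probability_setT.
  by rewrite sumEFin sumr_const card_ord.
elim: n E => [|n IHn] E iE nE Em.
  have := le_trans (shift_mass_ge1 m0 iE nE) Em.
  by rewrite lee_fin ler10.
have [atE|natE] := pselect (invariant_atom Q m E); first by exists E.
have [F iF [EF EdF]] : exists2 F, invariant m F & ~ null (E `&` F) /\ ~ null (E `\` F).
  apply: contrapT => none; apply: natE; split=> // F iF.
  by apply: contrapT => /not_orP EF; apply: none; exists F.
(* The discarded part of [E] outside [F] is non-null, so its mass is at least 1 and the bound drops
   from [n.+1] to [n]. *)
apply: (IHn (E `&` F)) => //; first exact: invariant_setI.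
have := shift_mass_ge1 m0 (invariant_setD iE iF) EdF.
move: Em; rewrite (shift_massDI iE iF) -natr1 EFinD => Em ge1.
have : 1 + shift_mass m (E `&` F) <= n%:R%:E + 1.
  by apply: le_trans Em; rewrite leeD2r.
by rewrite [1 + _]addeC leeD2rE.
Qed.

Section period.
Variables (m : nat) (A : set (paths s0)).
Hypothesis m_gt0 : (0 < m)%N.
Hypothesis A_atom : invariant_atom Q m A.

Let iA : invariant m A. Proof. by case: A_atom. Qed.
Let nA : ~ null A. Proof. by case: A_atom. Qed.

Let meets r := ~ null (A `&` shift r @^-1` A).

Let meets_sub r : meets r -> null (A `\` shift r @^-1` A).
Proof. by move=> Ar; case: A_atom => _ _ /(_ _ (invariant_shift r iA))[]. Qed.

(** An atom that meets one of its shifts almost lies in it, so the [r] for which this happens are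
    closed under addition; they are also periodic modulo [m], hence the multiples of a divisor [k]
    of [m]. *)
Lemma atom_period : exists2 k, (0 < k)%N && (k %| m)%N & forall a b,
  ~ null (shift a @^-1` A `&` shift b @^-1` A) <-> a = b %[mod k].
Proof.
have [k /andP[k0 km] kP] : exists2 k, (0 < k)%N && (k %| m)%N &
    forall r, meets r <-> (k %| r)%N.
  apply: periodic_submonoidP m_gt0 _ _ _.
  - by rewrite /meets preimage_shift0 setIid.
  - move=> a b /meets_sub Aa /meets_sub Ab Aab; apply: nA.
    have Aba := null_shift Q_markov Q_reach a m_gt0
      (invariant_setD iA (invariant_shift b iA)) Ab.
    apply: negligibleS (negligibleU Aab (negligibleU Aa Aba)) => w Aw.
    rewrite preimage_setD -preimage_shiftD (addnC b a).
    have [?|nAab] := pselect ((shift (a + b) @^-1` A) w); first by left.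
    by right; have [?|?] := pselect ((shift a @^-1` A) w); [right|left].
  - by move=> x y xy; rewrite /meets -(shift_modn x iA) xy shift_modn.
exists k; first by rewrite k0.
move=> a b.
(* A shift by [m.-1 * b] acts as a shift by [-b] modulo [m] and reduces a pair of shifts to [A] and
   a single shift. *)
have shiftE : shift (m.-1 * b) @^-1` (shift a @^-1` A `&` shift b @^-1` A) =
    A `&` shift (a + m.-1 * b) @^-1` A.
  rewrite preimage_setI -!preimage_shiftD -mulSn prednK// (mulnC m).
  by have [_ ->] := invariant_mulr b iA; rewrite setIC.
have <- : meets (a + m.-1 * b) <-> ~ null (shift a @^-1` A `&` shift b @^-1` A).
  rewrite /meets -shiftE.
  by split; apply: contra_not => /(null_shiftE Q_markov Q_reach _ m_gt0
       (invariant_setI (invariant_shift a iA) (invariant_shift b iA))).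
apply: iff_trans (kP _) _; split=> [/dvdnP[n ab]|ab].
  apply/eqP; rewrite -(eqn_modDr (m.-1 * b)) ab modnMl -mulSn prednK//.
  by rewrite eq_sym; apply: dvdn_mulr.
rewrite /dvdn -modnDml ab modnDml -mulSn prednK//; exact: dvdn_mulr.
Qed.

End period.

Lemma beta_or_prime m : (0 < m)%N -> beta Q (chain m) = 1 \/
  exists2 q, prime q & beta Q (chain q) = q%:R%:E.
Proof.
move=> m0; have [A atA] := exists_invariant_atom m0; have [iA nA _] := atA.
have [k /andP[k0 km] kP] := atom_period m0 atA.
have [k_gt1|k_le1] := ltnP 1 k; [right|left].
  pose q := pdiv k; have q_prime : prime q := pdiv_prime k_gt1.
  have q0 : (0 < q)%N := prime_gt0 q_prime.
  have qk : (q %| k)%N := pdiv_dvd k.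
  exists q => //; pose E r := shift r @^-1` orbit q A.
  have atO : invariant_atom Q q (orbit q A).
    by apply: invariant_atom_orbit atA => //; exact: dvdn_trans km.
  have [iO nO _] := atO.
  have atE r : invariant_atom Q q (E r) by exact: invariant_atom_shift.
  have iE r : invariant q (E r) by case: (atE r).
  (* The two orbits consist of shifts of [A] by numbers congruent to [r] and to [s] modulo [q]; as
     [q] divides [k], such numbers are never congruent modulo [k], and the copies are almost
     disjoint. *)
  have EE r s : (r < q)%N -> (s < q)%N -> r != s -> null (E r `&` E s).
    move=> rq sq rs; rewrite /E /orbit !preimage_bigcup setI_bigcupl.
    apply: negligible_bigcup => i; rewrite setI_bigcupr.
    apply: negligible_bigcup => j; rewrite -!preimage_shiftD.
    apply: contrapT => /kP ij; move/eqP: rs; apply.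
    have : (i * q + r = j * q + s %[mod q])%N.
      by rewrite -(modn_dvdm (i * q + r) qk) ij modn_dvdm.
    by rewrite !modnMDl !modn_small.
  apply: (beta_atomic_family Q_markov (B := fun r => majority Q (E r))) => //.
  - by move=> r _; exact: atomic_majority.
  - move=> r s rq sq [i Ei]; apply: contrapT => /eqP rs.
    have := majority_disjoint Q_markov Q_reach q0 (iE r) (iE s) (EE _ _ rq sq rs).
    by move=> E0; move: Ei; rewrite E0.
  - have : null (\bigcup_r (E r `\` ult q (majority Q (E r)))).
      by apply: negligible_bigcup => r; exact: null_setD_ult_majority.
    move=> /(negligibleU (null_orbit1C q0 iO nO)); apply: negligibleS => w nU.
    have [Ow|?] := pselect (orbit 1 (orbit q A) w); last by left.
    right; have := orbit1E q0 iO Ow.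
    rewrite -(bigcup_mkord q (fun r => shift r @^-1` orbit q A)) => -[r rq Er].
    by exists r => //; split=> // Mr; apply: nU; exists r.
have k1 : k = 1%N by apply/eqP; rewrite eqn_leq k_le1.
(* With period 1 every shift of [A] almost lies in [A], so [A] has full probability with its orbit,
   and the whole state space is atomic for the m-step chain. *)
have sA r : null (shift r @^-1` A `\` A).
  have [_ _ /(_ A iA)[]//] := invariant_atom_shift Q_markov Q_reach r m0 atA.
  rewrite -[X in _ `&` X]preimage_shift0 => As.
  by case: (iffRL (kP r 0%N) _ As); rewrite k1 !modn1.
have A1 : null (~` A).
  have : null (\bigcup_j (shift (j * 1) @^-1` A `\` A)) by apply: negligible_bigcup.
  rewrite -setD_bigcupl => /(negligibleU (null_orbit1C m0 iA nA)).
  apply: negligibleS => w nAw.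
  by have [?|?] := pselect (orbit 1 A w); [right|left].
apply: (beta_atomic_family Q_markov (q := 1) (B := fun=> setT)) => //.
- move=> r _; apply/(atomicE Q_markov _ m0); split; first exact: regular_setT.
  rewrite ult_setT; apply: (invariant_atom_equiv atA) => //.
    by rewrite setDT; exact: negligible_set0.
  by rewrite setTD.
- by move=> [|//] [|//].
- apply: negligibleS (negligible_set0 Q) => w; apply.
  by exists 0%N => //; rewrite ult_setT.
Qed.

End cyclic_structure.

(** * Reaching every state at a multiple of a given time *)

Section reachability.
Local Open Scope ereal_scope.
Context (R : realType) (S : countType) (s0 : S).
Variables (Q : probability (paths s0) R) (p : S -> S -> R).
Hypothesis p_ge0 : forall i j, (0 <= p i j)%R.

(** Positivity of [nstep] witnessed by an explicit word, which can be appended to a cylinder. *)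
Definition positive_path n i j :=
  exists v, [/\ size v = n, last i v = j & (0 < path_weight p i v)%R].

Lemma path_weight_cat i v u :
  path_weight p i (v ++ u) = (path_weight p i v * path_weight p (last i v) u)%R.
Proof. by elim: v i => [|j v IHv] i /=; rewrite ?mul1r// IHv mulrA. Qed.

Lemma positive_path_trans m n i j k :
  positive_path m i j -> positive_path n j k -> positive_path (m + n) i k.
Proof.
move=> [v [<- <- v0]] [u [<- <- u0]]; exists (v ++ u).
by rewrite size_cat last_cat path_weight_cat mulr_gt0.
Qed.

Lemma nstep_ge0 n i j : 0 <= nstep p n i j.
Proof.
elim: n i => [|n IHn] i /=; first by rewrite lee_fin.
by apply: esum_ge0 => k _; rewrite mule_ge0// lee_fin.
Qed.

Lemma nstep_positive_path n i j : 0 < nstep p n i j -> positive_path n i j.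
Proof.
elim: n i => [|n IHn] i /=.
  by case: eqP => [->|_]; [exists [::] => /=; rewrite ltr01|rewrite ltxx].
move=> pos; have [k pk] : exists k, 0 < (p i k)%:E * nstep p n k j.
  apply: contrapT => none; move: pos; rewrite esum1 ?ltxx// => k _.
  apply/eqP; rewrite eq_le mule_ge0 ?lee_fin ?nstep_ge0// andbT leNgt.
  by apply/negP => pk; apply: none; exists k.
have pik : (0 < p i k)%R.
  rewrite lt0r p_ge0 andbT; apply: contraTneq pk => ->.
  by rewrite mul0e ltxx.
have /IHn[v [<- <- v0]] : 0 < nstep p n k j.
  rewrite lt0e nstep_ge0 andbT; apply: contraTneq pk => ->.
  by rewrite mule0 ltxx.
by exists (k :: v); split=> //=; rewrite mulr_gt0.
Qed.

Hypothesis p_irreducible : irreducible p.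
Hypothesis p_aperiodic : aperiodic p.

(** The residues modulo [m] of loop lengths at [i] are the multiples of some [k]; this [k] divides
    all return times, so aperiodicity makes it 1. *)
Lemma positive_loop_mod m r i : (0 < m)%N ->
  exists2 n, n = r %[mod m] & positive_path n i i.
Proof.
move=> m0; pose H := [set r | exists2 n, n = r %[mod m] & positive_path n i i].
have [k _ HP] : exists2 k, (0 < k)%N && (k %| m)%N & forall x, H x <-> (k %| x)%N.
  apply: periodic_submonoidP m0 _ _ _.
  - by exists 0%N => //; exists [::]; split=> //=; rewrite ltr01.
  - move=> x y [a ax aP] [b bY bP]; exists (a + b)%N.
      by rewrite -modnDm ax bY modnDm.
    exact: positive_path_trans bP.
  - by move=> x y xy [a ax aP]; exists a => //; rewrite ax.
have /eqP k1 : k == 1%N.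
  rewrite -dvdn1; apply: (p_aperiodic i).2 => n [_ /nstep_positive_path nP]; apply/HP.
  by exists n.
by apply/HP; rewrite k1 dvd1n.
Qed.

Hypothesis Q_markov : markov_law Q p.

Lemma exists_initial_state : exists x, Q (cylinder [:: x]) != 0.
Proof.
apply: contrapT => none.
have mC (x : S) : measurable (@cylinder S s0 [:: x]) by exact: measurable_cylinder.
have : Q.-negligible (\bigcup_x @cylinder S s0 [:: x]).
  apply: negligible_countType_bigcup => // x; apply/negligibleP => //.
  by apply/eqP; apply: contrapT => /negP Qx; apply: none; exists x.
have -> : \bigcup_x @cylinder S s0 [:: x] = setT.
  by apply/seteqP; split=> // w _; exists (w 0%N).
exact: setT_not_negligible.
Qed.

Lemma reach_at_multiple m i : (0 < m)%N -> exists x s,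
  [/\ (m %| size s)%N, last x s = i & Q (cylinder (x :: s)) != 0].
Proof.
move=> m0; have [x Qx] := exists_initial_state.
have [a /nstep_positive_path xi] := p_irreducible x i.
(* A loop of length congruent to [m.-1 * a] corrects the length [a] to a multiple of [m]. *)
have [b ba ii] := positive_loop_mod (m.-1 * a) i m0.
have [s [sab si s_gt0]] := positive_path_trans xi ii.
exists x, s; split=> //.
  by rewrite sab /dvdn -modnDmr ba modnDmr -mulSn prednK// modnMr.
rewrite -[x :: s]/(x :: [::] ++ s) (cylinder_weight Q_markov) mule_eq0 negb_or Qx.
by rewrite eqe gt_eqF.
Qed.

End reachability.

(** * The dichotomy for the coordinate chain *)

Section canonical_chain.
Local Open Scope ereal_scope.
Context (R : realType) (S : countType) (s0 : S).
Variables (Q : probability (paths s0) R) (p : S -> S -> R).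
Hypothesis Q_markov : markov_law Q p.
Hypothesis Q_reach : forall m i, (0 < m)%N -> exists x s,
  [/\ (m %| size s)%N, last x s = i & Q (cylinder (x :: s)) != 0].

Local Notation chain m := (mstep (@coordinate S s0) m).
Local Notation ult m C := (ult_event (chain m) C).
Local Notation null E := (Q.-negligible E).

(** The default [set0] of [xget] counts 0, so a count of 1 certifies that a decomposition exists. *)
Lemma beta_eq1 d (T : measurableType d) (P : probability T R) (Y : nat -> T -> S) :
  beta P Y = 1 -> exists C, blackwell_decomposition P Y [set C].
Proof.
rewrite /beta; case: xgetP => [D -> bD /counting_eq1[C DC]|_].
  by exists C; rewrite -DC.
rewrite (counting_card_eq R (D := set0) (n := 0)) ?II0 ?card_eqxx//.
by move=> /eqP; rewrite eq_sym onee_eq0.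
Qed.

Lemma simple_or_prime : simple Q (chain 1) ->
  (forall m, (0 < m)%N -> simple Q (chain m)) \/
  (exists2 q, prime q & beta Q (chain q) = q%:R%:E).
Proof.
move=> /beta_eq1[C bC]; have acC := bd_almost_closed bC (erefl C).
have mC : measurable (ult 1 C) := (invariant_ult s0 1 C).1.
have C1 : null (~` ult 1 C).
  apply/negligibleP; first exact: measurableC.
  apply: etrans (probability_setC Q mC) _.
  have := bd_total bC; rewrite esum_set1; last exact: measure_ge0.
  by move=> ->; rewrite subee.
have [atC|natC] := pselect (atomic Q (chain 1) C).
  have [noprime|prime] := pselect (exists2 q, prime q & beta Q (chain q) = q%:R%:E).
    by right.
  have triv E : invariant 1 E -> null E \/ null (~` E).
    move=> iE; have [_ [_ _ /(_ E iE)]] := iffLR (atomicE Q_markov _ (ltn0Sn 0)) atC.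
    by case=> CE; [left|right]; apply: negligibleS (negligibleU C1 CE) => w Ew;
      have [?|?] := pselect (ult 1 C w); [right|left|right|left].
  by left=> m m0; have [//|//] := beta_or_prime Q_markov Q_reach triv m0.
left=> m m0; have nonatC : nonatomic Q (chain 1) C by split.
have [noatC transC] := bd_nonatomic bC (erefl C) nonatC.
have Cm : null (~` ult m C).
  by apply: negligibleS C1; apply: subsetC; exact: ult_mstep.
apply: (beta_nonatomic Q_markov m0 _ Cm).
- apply/almost_closedE; split; first by apply: negligibleS Cm => w [].
  by move=> /(negligibleU Cm); rewrite setUC setUv; exact: setT_not_negligible.
- by move=> A; exact: (no_invariant_atom Q_markov Q_reach m0 acC C1).
- move=> i Ci; apply/transientE; have /transientE := transC i Ci.
  by apply: negligibleS; exact: io_mstep.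
Qed.

End canonical_chain.

(** * Transfer between the sample space and the path space *)

Section transfer.
Local Open Scope ereal_scope.
Context (R : realType) (S : countType).
Context d1 (T1 : measurableType d1) (P1 : probability T1 R) (Y1 : nat -> T1 -> S).
Context d2 (T2 : measurableType d2) (P2 : probability T2 R) (Y2 : nat -> T2 -> S).
Hypothesis io_eq : forall C, P1 (io_event Y1 C) = P2 (io_event Y2 C).
Hypothesis ult_eq : forall C, P1 (ult_event Y1 C) = P2 (ult_event Y2 C).
Hypothesis io_ult_eq : forall C, P1 (io_event Y1 C `\` ult_event Y1 C) =
  P2 (io_event Y2 C `\` ult_event Y2 C).

(** Decompositions involve the chain only through these probabilities, so both [xget] select from
    the same predicate and return the same collection. *)
Lemma beta_transfer : beta P1 Y1 = beta P2 Y2.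
Proof.
have transE : transient P1 Y1 = transient P2 Y2.
  by apply/funext => C; rewrite /transient io_eq.
have acE : almost_closed P1 Y1 = almost_closed P2 Y2.
  by apply/funext => C; rewrite /almost_closed /regular io_ult_eq transE.
have atE : atomic P1 Y1 = atomic P2 Y2.
  by apply/funext => C; rewrite /atomic acE.
have natE : nonatomic P1 Y1 = nonatomic P2 Y2.
  by apply/funext => C; rewrite /nonatomic acE atE.
have totE D : \esum_(C in D) P1 (ult_event Y1 C) = \esum_(C in D) P2 (ult_event Y2 C).
  by apply: eq_esum => C _; exact: ult_eq.
rewrite /beta; congr (counting (xget _ _)); apply/funext => D; apply/propext.
split=> -[cD tD aD uD nD sumD]; split=> //.
- by rewrite -acE.
- by rewrite -natE.
- by rewrite -natE -atE -transE.
- by rewrite -totE.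
- by rewrite acE.
- by rewrite natE.
- by rewrite natE atE transE.
- by rewrite totE.
Qed.

End transfer.

Section path_law.
Local Open Scope ereal_scope.
Context (R : realType) d (T : measurableType d) (P : probability T R).
Context (S : countType) (p : S -> S -> R) (X : nat -> T -> S) (s0 : S).
Hypothesis X_markov : markov_chain P p X.

Definition sample_path (w : T) : paths s0 := fun n => X n w.

Lemma sample_path_cylinder x s : sample_path @^-1` cylinder (x :: s) =
  [set w | forall k, (k <= size s)%N -> X k w = nth s0 (x :: s) k].
Proof.
apply/seteqP; split=> w; rewrite /preimage/= => wxs.
  move=> k ks; rewrite -[X in nth _ X]wxs.
  by rewrite -[RHS]/(nth s0 (mkseq (sample_path w) (size s).+1) k) nth_mkseq.
apply: (@eq_from_nth _ s0); first by rewrite size_mkseq.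
by move=> k; rewrite size_mkseq => ks; rewrite nth_mkseq//; exact: wxs.
Qed.

Lemma measurable_sample_path : measurable_fun setT sample_path.
Proof.
apply: measurable_paths_valued => -[|x s]; first by rewrite cylinder0 preimage_setT.
rewrite sample_path_cylinder.
have -> : [set w | forall k, (k <= size s)%N -> X k w = nth s0 (x :: s) k] =
    \bigcap_(k in [set k | (k <= size s)%N]) (X k @^-1` [set nth s0 (x :: s) k]).
  by apply/seteqP; split.
by apply: bigcap_measurableType => k _; exact: X_markov.1.
Qed.

Definition path_law : probability (paths s0) R :=
  distribution P (mfun_Sub (mem_set measurable_sample_path)).

Lemma markov_path_law : markov_law path_law p.
Proof.
move=> x s j.
suff -> : path_law (cylinder (rcons (x :: s) j)) =
    P (sample_path @^-1` cylinder (x :: s) `&` X (size s).+1 @^-1` [set j]).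
  rewrite sample_path_cylinder X_markov.2 -sample_path_cylinder.
  by rewrite -[nth _ _ _]/(nth s0 (x :: s) (size (x :: s)).-1) nth_last.
congr (P _); transitivity (sample_path @^-1`
    (cylinder (x :: s) `&` shift (size (x :: s)) @^-1` cylinder [:: j])).
  by rewrite -cylinder_cat cats1.
rewrite preimage_setI; congr setI.
by apply/seteqP; split=> w; rewrite /preimage/= /cylinder/= /shift; [move=> [<-]|move=> <-].
Qed.

(** The events of [X] are by definition preimages under [sample_path] of the coordinate events, so
    the hypotheses of the transfer hold by computation. *)
Lemma beta_path_law m : (0 < m)%N ->
  beta path_law (mstep (@coordinate S s0) m) = beta P (mstep X m).
Proof. by move=> m0; apply: beta_transfer. Qed.

End path_law.

Theorem theorem8 (R : realType) (d : measure_display) (T : measurableType d)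
    (P : probability T R) (S : countType) (p : S -> S -> R)
    (X : nat -> T -> S)
    (S_infinite : infinite_set [set: S])
    (p_stochastic : stochastic p)
    (p_irreducible : irreducible p)
    (p_aperiodic : aperiodic p)
    (X_markov : markov_chain P p X)
    (X_simple : simple P X) :
  (asymptotically_aperiodic P X <->
     (forall m : nat, (1 < m)%N -> simple P (mstep X m))) /\
  ((forall m : nat, (1 < m)%N -> simple P (mstep X m)) <->
     (forall m : nat, prime m -> simple P (mstep X m))).
Proof.
(* A state is needed as base point of the path space; the chain at the default sample point supplies
   one. *)
pose s0 := X 0%N point; pose Q := path_law s0 X_markov.
have X1 : mstep X 1 = X by apply/funext => n; rewrite /mstep muln1.
have Q_simple : simple Q (mstep (@coordinate S s0) 1).
  by rewrite /simple beta_path_law// X1.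
have Q_markov : markov_law Q p by exact: markov_path_law.
have Q_reach := reach_at_multiple p_stochastic.1 p_irreducible p_aperiodic Q_markov.
have asE q : beta P (mstep X q) = q%:R%:E -> (0 < q)%N ->
    (q%:R%:E <= asymptotic_period P X)%E.
  by move=> bq q0; apply: ereal_sup_ubound; exists q.
have [Xm|[q q_prime]] := simple_or_prime Q_markov Q_reach Q_simple.
  have {}Xm m : (0 < m)%N -> simple P (mstep X m).
    by move=> m0; rewrite /simple -(beta_path_law s0 X_markov m0); exact: Xm.
  have asym : asymptotically_aperiodic P X.
    have as_ge1 : (1 <= asymptotic_period P X)%E.
      by apply: (asE 1%N) => //; rewrite X1.
    apply/eqP; rewrite eq_le as_ge1 andbT; apply: ge_ereal_sup => _ [m [m0 bm] <-].
    by rewrite -bm (Xm m m0).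
  split; split=> // _ m; first by move=> /ltnW; exact: Xm.
    by move=> /prime_gt0; exact: Xm.
  by move=> /ltnW; exact: Xm.
rewrite beta_path_law ?prime_gt0// => bq.
have q1 := prime_gt1 q_prime.
have not_simple : ~ simple P (mstep X q).
  by rewrite /simple bq => -[] /eqP; rewrite pnatr_eq1 gtn_eqF.
(* Here all three statements fail: the period is at least [q > 1], and the q-step chain is not
   simple. *)
split; split.
- move=> as1; have := asE q bq (prime_gt0 q_prime).
  by rewrite as1 lee_fin lern1 leqNgt q1.
- by move=> /(_ q q1)/not_simple.
- by move=> /(_ q q1)/not_simple.
- by move=> /(_ q q_prime)/not_simple.
Qed.
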